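(* Let $A$ be a finite-dimensional $\mathsf{k}$-algebra and let $B$ be a local finite-dimensional $\mathsf{k}$-algebra, where $\mathsf{k}$ is an algebraically closed field. Then $$\mathsf{FPdim}(A\otimes_{\mathsf k} B)=\mathsf{FPdim}(A)+\mathsf{FPdim}(B).$$
   Context: $\mathsf{k}$ is an algebraically closed field. An algebra means a (nonzero, unital, associative) finite-dimensional $\mathsf{k}$-algebra, not assumed connected; modules are finitely generated right modules, and $\mathsf{mod}\,A$ is the category of such $A$-modules. A module $S$ is a brick if $\mathrm{End}_A(S)$ is a division ring (equivalently $\mathrm{End}_A(S)\simeq\mathsf{k}$). A semibrick is a (possibly empty) set $\mathcal S$ of pairwise non-isomorphic bricks with $\mathrm{Hom}_A(S,S')=0$ for all non-isomorphic $S,S'\in\mathcal S$. For a finite semibrick $\mathcal S$, the $\mathrm{Ext}$-quiver $Q_{\mathcal S}$ has vertex set $\mathcal S$ and exactly $\dim_{\mathsf k}\mathrm{Ext}^1_A(S,S')$ arrows from $S$ to $S'$ (loops included). For a quiver $Q$, $\rho(Q)$ is the spectral radius (largest modulus of an eigenvalue) of its adjacency matrix, with $\rho=0$ for the empty quiver. The Frobenius--Perron dimension of $A$ is $\mathsf{FPdim}(A)=\sup\{\rho(Q_{\mathcal S})\mid \mathcal S \text{ a finite semibrick in } \mathsf{mod}\,A\}\in[0,\infty]$. *)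

(* Defs.v *)
From HB Require Import structures.
From mathcomp Require Import all_boot all_order all_algebra all_field.
From mathcomp Require Import complex.
From mathcomp Require Import boolp classical_sets reals constructive_ereal ereal.

Set Implicit Arguments.
Unset Strict Implicit.
Unset Printing Implicit Defensive.

Import Order.TTheory GRing.Theory Num.Theory.
Local Open Scope ring_scope.

Section TensorSpace.
Import VectorInternalTheory.
Variable k : fieldType.

(* The tensor product of two vector spaces, in coordinates: (v (x) w) is the
   rank-one matrix of products of coordinates.  [tliftE], [tlift_linear] and
   [tensor_ext] are its universal property. *)
Definition tensor (V W : vectType k) : Type := 'M[k]_(dim V, dim W).

HB.instance Definition _ (V W : vectType k) := Vector.on (tensor V W).

Definition tens (V W : vectType k) (v : V) (w : W) : tensor V W :=
  (v2r v)^T *m v2r w.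

Definition tlift (V W X : vectType k) (b : V -> W -> X) (t : tensor V W) : X :=
  \sum_i \sum_j
    (t : 'M_(_, _)) i j *: b (r2v (delta_mx 0 i)) (r2v (delta_mx 0 j)).

Variables V W X : vectType k.

Lemma tens_linl (w : W) : linear (fun v : V => tens v w).
Proof. by move=> c u v; rewrite /tens !linearP /= mulmxDl -scalemxAl. Qed.

Lemma tens_linr (v : V) : linear (fun w : W => tens v w).
Proof. by move=> c u w; rewrite /tens !linearP /=. Qed.

Lemma tlift_linear (b : V -> W -> X) : linear (tlift b).
Proof.
move=> c s t; rewrite /tlift scaler_sumr -big_split /=.
apply: eq_bigr => i _; rewrite scaler_sumr -big_split /=.
by apply: eq_bigr => j _; rewrite !mxE scalerDl scalerA.
Qed.

HB.instance Definition _ (b : V -> W -> X) :=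
  GRing.isLinear.Build k (tensor V W) X _ (tlift b) (tlift_linear b).

Lemma tlift_comb (b b1 b2 : V -> W -> X) c t :
    (forall v w, b v w = c *: b1 v w + b2 v w) ->
  tlift b t = c *: tlift b1 t + tlift b2 t.
Proof.
move=> bE; rewrite /tlift scaler_sumr -big_split /=.
apply: eq_bigr => i _; rewrite scaler_sumr -big_split /=.
by apply: eq_bigr => j _; rewrite bE scalerDr !scalerA mulrC.
Qed.

Lemma v2r_sum (U : vectType k) (u : U) :
  u = \sum_i v2r u 0 i *: r2v (delta_mx 0 i).
Proof.
apply: v2r_inj; rewrite linear_sum /= [LHS]row_sum_delta.
by apply: eq_bigr => i _; rewrite linearZ /= r2vK.
Qed.

Lemma tliftE (b : V -> W -> X) :
    (forall w, linear (b^~ w)) -> (forall v, linear (b v)) ->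
  forall v w, tlift b (tens v w) = b v w.
Proof.
move=> bl br v w.
pose bL w := GRing.isLinear.Build k V X _ (b^~ w) (bl w).
pose BL w : {linear V -> X} := HB.pack (b^~ w) (bL w).
pose bR v := GRing.isLinear.Build k W X _ (b v) (br v).
pose BR v : {linear W -> X} := HB.pack (b v) (bR v).
rewrite [in RHS](v2r_sum v) -[b _ w]/(BL w _) linear_sum /tlift.
apply: eq_bigr => i _; rewrite linearZ /= [in RHS](v2r_sum w).
rewrite -[b _ (\sum_j _)]/(BR _ _) linear_sum scaler_sumr.
by apply: eq_bigr => j _; rewrite linearZ /= scalerA !mxE big_ord1 !mxE.
Qed.

Lemma tens_ind (P : tensor V W -> Prop) :
    P 0 -> (forall s t, P s -> P t -> P (s + t)) ->
    (forall v w, P (tens v w)) -> forall t, P t.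
Proof.
move=> P0 PD Pt t; rewrite [t]matrix_sum_delta.
apply: (big_ind P) => // i _; apply: (big_ind P) => // j _.
set c := t i j.
suff -> : c *: delta_mx i j = tens (r2v (c *: delta_mx 0 i)) (r2v (delta_mx 0 j)).
  exact: Pt.
rewrite /tens !r2vK linearZ /= -scalemxAl trmx_delta.
by rewrite mul_delta_mx.
Qed.

Lemma tensor_ext (f g : tensor V W -> X) :
    linear f -> linear g ->
  (forall v w, f (tens v w) = g (tens v w)) -> f =1 g.
Proof.
move=> lf lg fg.
pose F : {linear tensor V W -> X} :=
  HB.pack f (GRing.isLinear.Build k (tensor V W) X _ f lf).
pose G : {linear tensor V W -> X} :=
  HB.pack g (GRing.isLinear.Build k (tensor V W) X _ g lg).
have F0 : F =1 G by apply: tens_ind => [|s t|//]; rewrite ?linear0 // !linearD => -> ->.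
exact: F0.
Qed.

End TensorSpace.

Section TensorAlgebra.
Import VectorInternalTheory.
Variables (k : fieldType) (A B : falgType k).
Local Notation T := (tensor A B).

Definition tensor_mul (s t : T) : T :=
  tlift (fun a b => tlift (fun a' b' => tens (a * a') (b * b')) t) s.

Definition tensor_one : T := tens 1 1.

Fact tensor_mul_linl t : linear (tensor_mul^~ t).
Proof. exact: tlift_linear. Qed.

Fact tensor_mul_linr s : linear (tensor_mul s).
Proof.
by move=> c t t'; apply: tlift_comb => a b; apply: tlift_linear.
Qed.

Lemma tensor_mulE a a' b b' :
  tensor_mul (tens a b) (tens a' b') = tens (a * a') (b * b').
Proof.
rewrite /tensor_mul tliftE ?tliftE // => v c x y.
- by rewrite mulrDr -scalerAr tens_linl.
- by rewrite mulrDr -scalerAr tens_linr.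
- by apply: tlift_comb => v' w'; rewrite mulrDl -scalerAl tens_linl.
- by apply: tlift_comb => v' w'; rewrite mulrDl -scalerAl tens_linr.
Qed.

Fact tensor_mulDl : left_distributive tensor_mul +%R.
Proof.
by move=> s t u; have := tensor_mul_linl u 1 s t; rewrite !scale1r.
Qed.

Fact tensor_mulDr : right_distributive tensor_mul +%R.
Proof.
by move=> s t u; have := tensor_mul_linr s 1 t u; rewrite !scale1r.
Qed.

Fact tensor_mul0l t : tensor_mul 0 t = 0.
Proof.
by have := tensor_mul_linl t (-1) 0 0; rewrite scaler0 addr0 scaleN1r addNr.
Qed.

Fact tensor_mul0r t : tensor_mul t 0 = 0.
Proof.
by have := tensor_mul_linr t (-1) 0 0; rewrite scaler0 addr0 scaleN1r addNr.
Qed.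

Fact tensor_mulA : associative tensor_mul.
Proof.
move=> s t u; elim/tens_ind: s => [|s s' ss ss'|a b].
- by rewrite !tensor_mul0l.
- by rewrite !tensor_mulDl ss ss'.
elim/tens_ind: t => [|t t' tt tt'|a' b'].
- by rewrite tensor_mul0l tensor_mul0r tensor_mul0l.
- by rewrite tensor_mulDl !tensor_mulDr tensor_mulDl tt tt'.
elim/tens_ind: u => [|u u' uu uu'|a2 b2].
- by rewrite !tensor_mul0r.
- by rewrite !tensor_mulDr uu uu'.
by rewrite !tensor_mulE !mulrA.
Qed.

Fact tensor_mul1l : left_id tensor_one tensor_mul.
Proof.
elim/tens_ind => [|t t' tt tt'|a b]; first by rewrite tensor_mul0r.
  by rewrite tensor_mulDr tt tt'.
by rewrite tensor_mulE !mul1r.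
Qed.

Fact tensor_mul1r : right_id tensor_one tensor_mul.
Proof.
elim/tens_ind => [|t t' tt tt'|a b]; first by rewrite tensor_mul0l.
  by rewrite tensor_mulDl tt tt'.
by rewrite tensor_mulE !mulr1.
Qed.

Fact tensor_one_neq0 : tensor_one != 0.
Proof.
apply/eqP => /matrixP t0; have /eqP := oner_neq0 A; apply.
apply: v2r_inj; rewrite linear0; apply/rowP => i; rewrite mxE.
apply/eqP/contraT => ai; have /eqP := oner_neq0 B; case.
apply: v2r_inj; rewrite linear0; apply/rowP => j; rewrite mxE.
have /eqP := t0 i j; rewrite !mxE big_ord1 !mxE mulf_eq0.
by rewrite (negPf ai) => /eqP.
Qed.

HB.instance Definition _ := GRing.Zmodule_isNzRing.Build T
  tensor_mulA tensor_mul1l tensor_mul1r tensor_mulDl tensor_mulDr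
  tensor_one_neq0.

Fact tensor_scaleAl c (s t : T) : c *: (s * t) = c *: s * t.
Proof. by have := tensor_mul_linl t c s 0; rewrite !(addr0, tensor_mul0l). Qed.

Fact tensor_scaleAr c (s t : T) : c *: (s * t) = s * (c *: t).
Proof. by have := tensor_mul_linr s c t 0; rewrite !(addr0, tensor_mul0r). Qed.

HB.instance Definition _ :=
  GRing.Lmodule_isLalgebra.Build k T tensor_scaleAl.
HB.instance Definition _ :=
  GRing.Lalgebra_isAlgebra.Build k T tensor_scaleAr.
HB.instance Definition _ := Algebra_isFalgebra.Build k T.

Lemma tens_mul a a' b b' :
  tens a b * tens a' b' = tens (a * a') (b * b') :> T.
Proof. exact: tensor_mulE. Qed.

End TensorAlgebra.

Notation "A \tensor B" := (tensor A B : falgType _)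
  (at level 40, left associativity).

Section Modules.
Variables (k : fieldType) (A : falgType k).

(* Finitely generated right A-modules: since A is finite-dimensional, these are
   the right A-modules that are finite-dimensional over k. *)
Record rmod := RMod {
  rcarrier :> vectType k;
  ract : rcarrier -> A -> rcarrier;
  ract_linl : forall a, linear (ract^~ a);
  ract_linr : forall m, linear (ract m);
  ract1 : forall m, ract m 1 = m;
  ractM : forall m a b, ract m (a * b) = ract (ract m a) b }.

Lemma ract0 (M : rmod) a : ract (0 : M) a = 0.
Proof.
by have := ract_linl a (-1) (0 : M) 0; rewrite scaler0 addr0 scaleN1r addNr.
Qed.

Lemma linfunE (U V : vectType k) (f : U -> V) : linear f -> linfun f =1 f.
Proof.
move=> lf u; pose F : {linear U -> V} :=
  HB.pack f (GRing.isLinear.Build k U V _ f lf).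
exact: (lfunE F).
Qed.

Definition commutator (M N : rmod) (f : 'Hom(M, N)) : 'Hom(A, 'Hom(M, N)) :=
  linfun (fun a => linfun (fun m => f (ract m a) - ract (f m) a)).

(* Hom_A(M, N), as a k-subspace of Hom_k(M, N); see [homAP]. *)
Definition homA (M N : rmod) : {vspace 'Hom(M, N)} :=
  lker (linfun (@commutator M N)).

Lemma commutatorE (M N : rmod) (f : 'Hom(M, N)) a m :
  commutator f a m = f (ract m a) - ract (f m) a.
Proof.
have inl b : linear (fun m => f (ract m b) - ract (f m) b).
  by move=> c x y; rewrite ract_linl !linearP /= ract_linl scalerBr opprD addrACA.
rewrite /commutator linfunE ?linfunE // => c x y; apply/lfunP => z.
rewrite add_lfunE scale_lfunE !linfunE //.
by rewrite !ract_linr linearP scalerBr opprD addrACA.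
Qed.

Lemma homAP (M N : rmod) (f : 'Hom(M, N)) :
  reflect (forall m a, f (ract m a) = ract (f m) a) (f \in homA M N).
Proof.
rewrite memv_ker linfunE; last first.
  move=> c g h; apply/lfunP => a; apply/lfunP => m.
  rewrite !(add_lfunE, scale_lfunE) !commutatorE !(add_lfunE, scale_lfunE).
  by rewrite ract_linl scalerBr opprD addrACA.
apply: (iffP eqP) => [f0 m a|fA].
  by apply/eqP; rewrite -subr_eq0 -commutatorE f0 !zero_lfunE.
apply/lfunP => a; apply/lfunP => m.
by rewrite commutatorE fA subrr !zero_lfunE.
Qed.

(* The canonical free cover M (x)_k A -> M, m (x) a |-> m a, and its kernel.
   [cover_free] and [cover_hom_ext] say that the cover is free on M. *)
Section Cover.
Variable M : rmod.

Definition cover_act (t : tensor M A) (a : A) : tensor M A :=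
  tlift (fun m b => tens m (b * a)) t.

Fact cover_act_linl a : linear (cover_act^~ a).
Proof. exact: tlift_linear. Qed.

Fact cover_act_linr t : linear (cover_act t).
Proof.
move=> c a b; apply: tlift_comb => m d.
by rewrite mulrDr -scalerAr tens_linr.
Qed.

Lemma cover_actE m b a : cover_act (tens m b) a = tens m (b * a).
Proof.
rewrite /cover_act tliftE // => v c x y; first by rewrite tens_linl.
by rewrite mulrDl -scalerAl tens_linr.
Qed.

Fact cover_actD s t a : cover_act (s + t) a = cover_act s a + cover_act t a.
Proof. exact: linearD. Qed.

Fact cover_act0 a : cover_act 0 a = 0.
Proof. exact: linear0. Qed.

Fact cover_act1 t : cover_act t 1 = t.
Proof.
elim/tens_ind: t => [|s t ss tt|m b]; first exact: cover_act0.
  by rewrite cover_actD ss tt.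
by rewrite cover_actE mulr1.
Qed.

Fact cover_actM t a b : cover_act t (a * b) = cover_act (cover_act t a) b.
Proof.
elim/tens_ind: t => [|s t ss tt|m d]; first by rewrite !cover_act0.
  by rewrite !cover_actD ss tt.
by rewrite !cover_actE mulrA.
Qed.

Definition cover : rmod :=
  RMod cover_act_linl cover_act_linr cover_act1 cover_actM.

Definition cover_map : 'Hom(cover, M) :=
  linfun (tlift (fun (m : M) a => ract m a)).

Lemma cover_mapE m a : cover_map (tens m a) = ract m a.
Proof.
rewrite linfunE; last exact: tlift_linear.
by rewrite tliftE // => v c x y; rewrite ?ract_linl ?ract_linr.
Qed.

Lemma cover_map_hom : cover_map \in homA cover M.
Proof.
apply/homAP => t a; rewrite -[ract t a]/(cover_act t a).
elim/tens_ind: t => [|s t ss tt|m b].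
- by rewrite cover_act0 !linear0 ract0.
- have := ract_linl a 1 (cover_map s) (cover_map t).
  by rewrite cover_actD !linearD /= ss tt !scale1r.
- by rewrite cover_actE !cover_mapE ractM.
Qed.

Lemma limg_cover_map : limg cover_map = fullv.
Proof.
apply/eqP; rewrite eqEsubv subvf /=; apply/subvP => m _.
by apply/memv_imgP; exists (tens m 1); rewrite ?memvf // cover_mapE ract1.
Qed.

Lemma cover_free (N : rmod) (g : 'Hom(M, N)) :
  exists2 f, f \in homA cover N & forall m, f (tens m 1) = g m.
Proof.
pose f0 : tensor M A -> N := tlift (fun (m : M) a => ract (g m) a).
have fE m a : f0 (tens m a) = ract (g m) a.
  rewrite /f0 tliftE // => v c x y; last by rewrite ract_linr.
  by rewrite linearP ract_linl.
have f0P : linear f0 by apply: tlift_linear.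
exists (linfun f0 : 'Hom(cover, N)) => [|m]; last first.
  by rewrite (linfunE f0P) fE ract1.
apply/homAP => t a; rewrite !(linfunE f0P) -[ract t a]/(cover_act t a).
elim/tens_ind: t => [|s t ss tt|m b].
- by rewrite cover_act0 /f0 !linear0 ract0.
- have f0D x y : f0 (x + y) = f0 x + f0 y by apply: linearD.
  have := ract_linl a 1 (f0 s) (f0 t).
  by rewrite cover_actD !f0D ss tt !scale1r.
- by rewrite cover_actE !fE ractM.
Qed.

Lemma cover_hom_ext (N : rmod) (f f' : 'Hom(cover, N)) :
    f \in homA cover N -> f' \in homA cover N ->
  (forall m, f (tens m 1) = f' (tens m 1)) -> f = f'.
Proof.
move=> /homAP fA /homAP f'A ff'; apply/lfunP; elim/tens_ind => [|s t ss tt|m a].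
- by rewrite !linear0.
- by rewrite !linearD /= ss tt.
by rewrite -[a]mul1r -cover_actE -[cover_act _ _]/(@ract cover _ _) fA f'A ff'.
Qed.

Definition syz_act (u : subvs_of (lker cover_map)) (a : A) :
    subvs_of (lker cover_map) :=
  vsproj (lker cover_map) (@ract cover (vsval u) a).

Lemma syz_actE u a : vsval (syz_act u a) = @ract cover (vsval u) a.
Proof.
apply: vsprojK; rewrite memv_ker (homAP _ cover_map_hom).
by have := subvsP u; rewrite memv_ker => /eqP ->; rewrite ract0.
Qed.

Fact syz_act_linl a : linear (syz_act^~ a).
Proof.
move=> c u v; apply: subvs_inj.
have vP x y : vsval (c *: x + y) = c *: vsval x + vsval y by apply: linearP.
by rewrite syz_actE [RHS]vP !syz_actE vP ract_linl.
Qed.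

Fact syz_act_linr u : linear (syz_act u).
Proof.
move=> c a b; apply: subvs_inj.
have vP x y : vsval (c *: x + y) = c *: vsval x + vsval y by apply: linearP.
by rewrite syz_actE [RHS]vP !syz_actE ract_linr.
Qed.

Fact syz_act1 u : syz_act u 1 = u.
Proof. by apply: subvs_inj; rewrite syz_actE ract1. Qed.

Fact syz_actM u a b : syz_act u (a * b) = syz_act (syz_act u a) b.
Proof. by apply: subvs_inj; rewrite !syz_actE ractM. Qed.

Definition syz : rmod := RMod syz_act_linl syz_act_linr syz_act1 syz_actM.

Definition syz_incl : 'Hom(syz, cover) := linfun vsval.

Lemma limg_syz_incl : limg syz_incl = lker cover_map.
Proof.
apply/vspaceP => t; apply/memv_imgP/idP => [[u _ ->]|tK].
  by rewrite lfunE subvsP.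
by exists (vsproj (lker cover_map) t); rewrite ?memvf // lfunE /= vsprojK.
Qed.

Lemma cover_map_incl (u : syz) : cover_map (syz_incl u) = 0.
Proof. by apply/eqP; rewrite -memv_ker lfunE subvsP. Qed.

End Cover.

(* The canonical free resolution ... -> P_1 -> P_0 -> M -> 0, obtained by
   splicing canonical free covers of the iterated syzygies. *)
Definition res (M : rmod) (n : nat) : rmod := cover (iter n syz M).

Definition res_d (M : rmod) (n : nat) : 'Hom(res M n.+1, res M n) :=
  (syz_incl (iter n syz M) \o cover_map (iter n.+1 syz M))%VF.

(* Ext^1_A(M, N) = Z^1 / B^1, the first cohomology of Hom_A(P_*, N); by
   [ext1_coboundaries_sub] the subtraction in [dim_ext1] is never truncated. *)
Definition ext1_cocycles (M N : rmod) : {vspace 'Hom(res M 1, N)} :=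
  (homA (res M 1) N :&: lker (linfun (fun f => f \o res_d M 1)%VF))%VS.

Definition ext1_coboundaries (M N : rmod) : {vspace 'Hom(res M 1, N)} :=
  (linfun (fun f => f \o res_d M 0)%VF @: homA (res M 0) N)%VS.

Definition dim_ext1 (M N : rmod) : nat :=
  \dim (ext1_cocycles M N) - \dim (ext1_coboundaries M N).

Lemma res_d_hom M n : res_d M n \in homA (res M n.+1) (res M n).
Proof.
apply/homAP => t a; rewrite /res_d !comp_lfunE (homAP _ (cover_map_hom _)).
by rewrite /syz_incl !lfunE /= syz_actE.
Qed.

Lemma res_dd M n : (res_d M n \o res_d M n.+1 = 0)%VF.
Proof.
apply/lfunP => t; rewrite zero_lfunE !comp_lfunE.
by rewrite [cover_map _ (syz_incl _ _)]cover_map_incl linear0.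
Qed.

Lemma comp_lfun_linear (U V W : vectType k) (d : 'Hom(U, V)) :
  linear (fun f : 'Hom(V, W) => (f \o d)%VF).
Proof. by move=> c g h; rewrite comp_lfunDl comp_lfunZl. Qed.

Lemma ext1_coboundaries_sub M N :
  (ext1_coboundaries M N <= ext1_cocycles M N)%VS.
Proof.
apply/subvP => _ /memv_imgP[f /homAP fA ->].
rewrite (linfunE (@comp_lfun_linear _ _ _ _)) memv_cap; apply/andP; split.
  apply/homAP => m a; rewrite !(comp_lfunE f).
  have /homAP/(_ m a) dA := res_d_hom M 0.
  exact: etrans (congr1 f dA) (fA _ _).
rewrite memv_ker (linfunE (@comp_lfun_linear _ _ _ _)).
by rewrite -comp_lfunA res_dd comp_lfun0r.
Qed.

Definition isomorphic (M N : rmod) : Prop :=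
  exists f g, [/\ f \in homA M N, g \in homA N M,
                  (g \o f)%VF = \1%VF & (f \o g)%VF = \1%VF].

(* End_A(S) is a division ring. *)
Definition brick (S : rmod) : Prop :=
  \1%VF != 0 :> 'End(S) /\
  forall f, f \in homA S S -> f != 0 ->
    exists g, [/\ g \in homA S S, (g \o f)%VF = \1%VF & (f \o g)%VF = \1%VF].

(* A finite semibrick, listed without repetition. *)
Definition semibrick (n : nat) (S : 'I_n -> rmod) : Prop :=
  (forall i, brick (S i)) /\
  (forall i j, i != j ->
     ~ isomorphic (S i) (S j) /\ homA (S i) (S j) = 0%VS).

(* The Ext-quiver of S, given by its adjacency matrix. *)
Definition ext_quiver (n : nat) (S : 'I_n -> rmod) : 'M[nat]_n :=
  \matrix_(i, j) dim_ext1 (S i) (S j).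

End Modules.

(* For n = 0 there is no eigenvalue, and [sup set0 = 0]. *)
Definition spectral_radius (R : realType) (n : nat) (Q : 'M[nat]_n) : R :=
  sup [set x : R | exists2 z : R[i],
    eigenvalue (map_mx (fun m => m%:R) Q) z & x = Normc.normc z]%classic.

Definition FPdim (R : realType) (k : fieldType) (A : falgType k) : \bar R :=
  ereal_sup [set x | exists (n : nat) (S : 'I_n -> rmod A),
    semibrick S /\ x = (spectral_radius R (ext_quiver S))%:E]%classic.

Section Local.
Variables (k : fieldType) (B : falgType k).

Definition right_ideal (I : {vspace B}) : Prop := (I * fullv <= I)%VS.

Definition maximal_right_ideal (I : {vspace B}) : Prop :=
  [/\ right_ideal I, I <> fullv &
      forall J, right_ideal J -> (I <= J)%VS -> J = I \/ J = fullv].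

Definition local_algebra : Prop := exists! I, maximal_right_ideal I.

End Local.

(* Main.v *)
Require Import Defs.
From mathcomp Require Import all_boot all_order all_algebra all_field.
From mathcomp Require Import reals constructive_ereal.
From mathcomp Require Import complex lra.
From mathcomp Require Import boolp classical_sets ereal.

(* Since B is local and k is algebraically closed, B = k + I with I the
   nilpotent kernel of an augmentation eps : B -> k.  If I did not annihilate a
   brick over A (x) B, an element of the last power of I acting nontrivially
   would act by a nonzero nilpotent endomorphism; hence the semibricks over
   A (x) B are exactly the inflations along eps of those over A.  Writing Ext^1
   as crossed homomorphisms modulo inner ones, one finds
     Ext^1_(A (x) B)(M, N) = Ext^1_A(M, N) + Hom_A(M, N) (x) Der_eps(B, k)
   for inflated M and N, so that inflation adds d = dim Der_eps(B, k) to each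
   diagonal entry of the Ext-quiver of a semibrick.  By Perron-Frobenius this
   adds d to its spectral radius, and d = FPdim B because the only brick over B
   is k. *)

Set Implicit Arguments.
Unset Strict Implicit.
Unset Printing Implicit Defensive.

Import Order.TTheory GRing.Theory Num.Theory.
Local Open Scope ring_scope.

(** * Spectral radius of a nonnegative matrix *)

Section Perron.
Variables (R : realType) (n : nat) (Q : 'M[R]_n).
Hypothesis Q_ge0 : forall i j, 0 <= Q i j.

(* t%:M - Q is a monotone matrix: its inverse exists and is nonnegative. *)
Definition monotone_at (t : R) : Prop := forall y : 'rV[R]_n,
  (forall j, (y *m Q) 0 j <= t * y 0 j) -> forall j, 0 <= y 0 j.

Lemma ler_sum_coord (u : 'I_n -> R) j :
  (forall i, 0 <= u i) -> u j <= \sum_i u i.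
Proof. by move=> u0; rewrite (bigD1 j) //= lerDl sumr_ge0. Qed.

(** At a least coordinate y_j, the entry (yQ)_j is at least y_j times the j-th column sum. If y_j
    were negative, t would be bounded by that column sum. *)
Lemma monotone_at_ge t : \sum_i \sum_j Q i j < t -> monotone_at t.
Proof.
move=> tQ y yQ j0.
have [j _ jmin] := arg_minP (fun j => y 0 j) (isT : xpredT j0).
apply: le_trans (jmin j0 isT); rewrite leNgt; apply/negP => yj.
have : t <= \sum_i Q i j.
  rewrite -(ler_nM2l yj) [_ * t]mulrC; apply: le_trans (yQ j).
  by rewrite mxE mulr_sumr; apply: ler_sum => i _; rewrite ler_wpM2r // jmin.
apply/negP; rewrite -ltNge; apply: le_lt_trans tQ.
by apply: ler_sum => i _; apply: (ler_sum_coord (u := Q i)).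
Qed.

Variables (tau : R) (u : 'rV[R]_n).
Hypothesis uE : forall j, (u *m Q) 0 j = tau * u 0 j - 1.

(** [uE] says that u (tau - Q) is the all-ones row. Adding a small multiple d u to a counterexample
    y keeps its j-th coordinate negative and gives every inequality a slack d. This absorbs an
    increase of tau by d / M, where M bounds the coordinates of y + d u. *)
Lemma monotone_at_right :
  (forall t, tau < t -> monotone_at t) -> monotone_at tau.
Proof.
move=> Pt y yQ j; rewrite leNgt; apply/negP => yj.
pose d := - y 0 j / (`|u 0 j| + 1) / 2.
have u1 : 0 < `|u 0 j| + 1 by rewrite ltr_wpDl.
have d0 : 0 < d by rewrite !divr_gt0 // oppr_gt0.
have dE : d * (`|u 0 j| + 1) * 2 = - y 0 j.
  by rewrite /d mulrAC divfK ?gt_eqF // divfK ?gt_eqF.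
pose w := y + d *: u.
have wE i : w 0 i = y 0 i + d * u 0 i by rewrite !mxE.
pose M := \sum_i `|w 0 i| + 1.
have M0 : 0 < M by rewrite ltr_wpDl // sumr_ge0.
have dM : d / M * M = d by rewrite divfK ?gt_eqF.
have wM i : `|w 0 i| <= M.
  by rewrite ler_wpDr //; apply: (ler_sum_coord (u := fun i => `|w 0 i|)).
have dM0 : 0 < d / M by rewrite divr_gt0.
have : 0 <= w 0 j.
  apply: (Pt (tau + d / M)) => [|i]; first by rewrite ltrDl.
  have -> : (w *m Q) 0 i = (y *m Q) 0 i + d * (u *m Q) 0 i.
    by rewrite mulmxDl -scalemxAl !mxE.
  have := yQ i; have := wM i; rewrite uE wE => wi yi.
  have : - (d / M * (y 0 i + d * u 0 i)) <= d / M * M.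
    by rewrite -mulrN ler_pM2l // (le_trans _ wi) // ler_normr lexx orbT.
  by rewrite dM; nra.
rewrite wE; have := ler_norm (u 0 j); nra.
Qed.

(** Monotonicity at tau makes u nonnegative. For e = tau - t and a least coordinate y_j < 0, the row
    w = y - e y_j u has (w (tau - Q))_i >= e (y_i - y_j) >= 0, while w_j = y_j (1 - e u_j) is
    negative because e u_j < 1. *)
Lemma monotone_at_left : monotone_at tau ->
  exists2 e, 0 < e & forall t, tau - e < t -> t <= tau -> monotone_at t.
Proof.
move=> Ptau.
have u0 : forall j, 0 <= u 0 j by apply: Ptau => j; rewrite uE gerBl.
have S0 : 0 < \sum_i u 0 i + 1 by rewrite ltr_wpDl // sumr_ge0.
exists (\sum_i u 0 i + 1)^-1; first by rewrite invr_gt0.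
move=> t tl tu y yQ j0.
have [j _ jmin] := arg_minP (fun j => y 0 j) (isT : xpredT j0).
apply: le_trans (jmin j0 isT); rewrite leNgt; apply/negP => yj.
pose e := tau - t; have e0 : 0 <= e by rewrite subr_ge0.
have eu : e * u 0 j < 1.
  have : e * (\sum_i u 0 i + 1) < 1.
    by rewrite -ltr_pdivlMr // mul1r /e; lra.
  have := ler_sum_coord j u0; rewrite /=; nra.
pose w := y + (- (e * y 0 j)) *: u.
have wE i : w 0 i = y 0 i - (e * y 0 j) * u 0 i by rewrite !mxE mulNr.
have : 0 <= w 0 j.
  apply: Ptau => i.
  have -> : (w *m Q) 0 i = (y *m Q) 0 i - (e * y 0 j) * (u *m Q) 0 i.
    by rewrite mulmxDl -scalemxAl !mxE mulNr.
  rewrite uE wE; have := yQ i; have /= := jmin i isT; rewrite /e in e0 *; nra.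
rewrite wE; nra.
Qed.

End Perron.

Lemma not_eigenvalue_unitmx (F : fieldType) n (Q : 'M[F]_n) t :
  ~~ eigenvalue Q t -> Q - t%:M \in unitmx.
Proof. by rewrite negbK kermx_eq0 row_free_unit. Qed.

(* If no t >= s were an eigenvalue, the supremum tau of the t at which t - Q is
   not monotone would satisfy tau >= s, since x witnesses s; but tau - Q is then
   invertible, so monotonicity extends from t > tau to tau, and a bit below. *)
Lemma perron (R : realType) n (Q : 'M[R]_n) (x : 'rV[R]_n) s :
    (forall i j, 0 <= Q i j) -> (forall j, 0 <= x 0 j) -> x != 0 ->
    (forall j, s * x 0 j <= (x *m Q) 0 j) ->
  exists2 t, s <= t & eigenvalue Q t.
Proof.
move=> Q0 x0 xN0 xQ; apply: contrapT => noeig.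
have unitQ t : s <= t ->
    exists u : 'rV[R]_n, forall j, (u *m Q) 0 j = t * u 0 j - 1.
  move=> st; have : Q - t%:M \in unitmx.
    by apply: not_eigenvalue_unitmx; apply/negP => et; apply: noeig; exists t.
  move=> Qu; exists (const_mx (-1) *m invmx (Q - t%:M)) => j.
  set u := (_ *m invmx _).
  have : u *m (Q - t%:M) = const_mx (-1) by rewrite /u mulmxKV.
  rewrite mulmxBr mul_mx_scalar; move: (u *m Q) (u) => v w.
  move=> /matrixP/(_ 0 j); rewrite !mxE.
  by move=> E; lra.
pose T := [set t | ~ monotone_at Q t]%classic.
have Ts : T s.
  move=> Ps; have /eqP := xN0; apply; apply/rowP => j; apply/eqP.
  rewrite mxE eq_le x0 andbT -oppr_ge0.
  suff : 0 <= (- x) 0 j by rewrite mxE.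
  apply: Ps => i.
  by rewrite mulNmx mxE [(- x) 0 i]mxE mulrN lerN2 xQ.
have Tub : ubound T (\sum_i \sum_j Q i j).
  by move=> t Tt; rewrite leNgt; apply/negP => /(monotone_at_ge Q0).
have Tsup : has_sup T by split; [exists s | exists (\sum_i \sum_j Q i j)].
pose tau := sup T.
have stau : s <= tau by apply: ub_le_sup => //; case: Tsup.
have [u uE] := unitQ _ stau.
have Pgt t : tau < t -> monotone_at Q t.
  move=> tt; apply: contrapT => Tt; have := ub_le_sup (proj2 Tsup) Tt.
  by rewrite leNgt tt.
have [e e0 Pe] := monotone_at_left uE (monotone_at_right uE Pgt).
have [t Tt tt] := sup_adherent e0 Tsup.
by case: (Tt); apply: Pe => //; apply: ub_le_sup => //; case: Tsup.
Qed.

(** * Spectral radius of a matrix of natural numbers *)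

Section SpectralRadius.
Variable R : realType.

Lemma normc_sum (I : finType) (F : I -> R[i]) :
  Normc.normc (\sum_i F i) <= \sum_i Normc.normc (F i).
Proof.
elim/big_rec2: _ => [|i y x _ xy]; first by rewrite Normc.normc0.
by apply: le_trans (le_normcD _ _) _; rewrite lerD2l.
Qed.

Lemma normc_nat m : Normc.normc (m%:R : R[i]) = m%:R.
Proof. by rewrite (normcMn 1) Normc.normc1. Qed.

Lemma normc_ge0 (z : R[i]) : 0 <= Normc.normc z.
Proof. by case: z => a b; rewrite sqrtr_ge0. Qed.

Lemma normc_nneg (t : R) : 0 <= t -> Normc.normc t%:C%C = t.
Proof. by move=> t0; rewrite /= expr0n addr0 sqrtr_sqr ger0_norm. Qed.

Definition spectrum n (Q : 'M[nat]_n) : set R :=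
  [set x : R | exists2 z : R[i],
    eigenvalue (map_mx (fun m => m%:R) Q) z & x = Normc.normc z]%classic.

Lemma spectral_radius0 (Q : 'M[nat]_0) : spectral_radius R Q = 0.
Proof.
rewrite /spectral_radius [X in sup X](_ : _ = set0) ?sup0 //.
apply/seteqP; split=> x //= [z /eigenvalueP[v _ /eqP[]]].
by apply/rowP; case.
Qed.

Variables (n : nat) (Q : 'M[nat]_n).
Local Notation QR := (map_mx (fun m => m%:R) Q : 'M[R]_n).
Local Notation QC := (map_mx (fun m => m%:R) Q : 'M[R[i]]_n).

Lemma map_real_complex_nat : map_mx (real_complex R) QR = QC.
Proof. by apply/matrixP => i j; rewrite !mxE rmorph_nat. Qed.

(** Taking moduli in v Q = z v, the triangle inequality gives |z| |v| <= |v| Q, to which [perron]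
    applies. *)
Lemma eigenvalue_real_dominates z : eigenvalue QC z ->
  exists2 t : R, Normc.normc z <= t & eigenvalue QR t.
Proof.
case/eigenvalueP => v vQ v0.
apply: (@perron _ _ _ (map_mx (@Normc.normc R) v)) => [i j|j||j].
- by rewrite mxE ler0n.
- by rewrite mxE normc_ge0.
- apply: contraNneq v0 => /matrixP v0; apply/eqP/rowP => j.
  by have := v0 0 j; rewrite !mxE => /Normc.eq0_normc.
have := congr1 (fun M : 'rV_n => Normc.normc (M 0 j)) vQ.
rewrite !mxE Normc.normcM => <-; apply: le_trans (normc_sum _) _.
by apply: ler_sum => i _; rewrite !mxE Normc.normcM normc_nat.
Qed.

(** Every modulus is dominated by a real eigenvalue t. If t exceeded the sum of all entries,
    monotonicity at t, applied to an eigenvector and to its negative, would make it zero. *)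
Lemma spectrum_bounded : has_ubound (spectrum Q).
Proof.
exists (\sum_i \sum_j QR i j) => _ [z /eigenvalue_real_dominates[t zt] et ->].
apply: le_trans zt _; rewrite leNgt; apply/negP => /monotone_at_ge Pt.
have {Pt}/Pt Pt : forall i j, 0 <= QR i j by move=> i j; rewrite mxE ler0n.
case/eigenvalueP: et => v vQ /eqP; apply; apply/rowP => j; apply/eqP.
rewrite mxE eq_le Pt => [|i]; last by rewrite vQ mxE.
rewrite andbT -oppr_ge0; suff: 0 <= (- v) 0 j by rewrite mxE.
by apply: Pt => i; rewrite mulNmx vQ mxE [(t *: v) 0 i]mxE [(- v) 0 i]mxE mulrN.
Qed.

Lemma spectrum_nonempty : (0 < n)%N -> (spectrum Q !=set0)%classic.
Proof. by move=> /(eigenvalue_closed QC)[z ez]; exists (Normc.normc z), z. Qed.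

Lemma normc_le_spectral_radius z :
  eigenvalue QC z -> Normc.normc z <= spectral_radius R Q.
Proof. by move=> ez; apply: (ub_le_sup spectrum_bounded); exists z. Qed.

Lemma spectral_radius_ge0 : 0 <= spectral_radius R Q.
Proof.
case: (posnP n) => [n0|/spectrum_nonempty [x Qx]].
  by move: Q; rewrite n0 => Q0; rewrite spectral_radius0.
apply: le_trans (ub_le_sup spectrum_bounded Qx).
by case: Qx => z _ ->; apply: normc_ge0.
Qed.

End SpectralRadius.

Lemma eigenvalue_add_scalar (F : fieldType) n (M : 'M[F]_n) a z :
  eigenvalue (M + a%:M) z = eigenvalue M (z - a).
Proof.
by rewrite /eigenvalue /eigenspace raddfB /= opprB addrCA addrAC addrC addrA.
Qed.

(** The upper bound is the triangle inequality. For the lower bound |z + d| may be smaller than |z|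
    + d, so z is first replaced by a real eigenvalue t >= |z|, for which |t + d| = t + d. The empty
    matrix is excluded: its radius is 0 by convention for every d. *)
Lemma spectral_radius_add_scalar (R : realType) n (Q : 'M[nat]_n) d :
    (0 < n)%N ->
  spectral_radius R (\matrix_(i, j) (Q i j + (i == j) * d)%N)
    = spectral_radius R Q + d%:R.
Proof.
move=> n0; set Q' := \matrix_(i, j) _.
have QE (F : numFieldType) : map_mx (fun m => m%:R) Q' =
    map_mx (fun m => m%:R) Q + (d%:R)%:M :> 'M[F]_n.
  by apply/matrixP => i j; rewrite !mxE natrD natrM mulr_natl mulrb; case: eqP.
apply/eqP; rewrite eq_le; apply/andP; split.
  apply: ge_sup; first exact: spectrum_nonempty.
  move=> _ [z ez ->]; rewrite QE eigenvalue_add_scalar in ez.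
  rewrite -[z](subrK d%:R); apply: le_trans (le_normcD _ _) _.
  by rewrite normc_nat lerD2r normc_le_spectral_radius.
rewrite -lerBrDr; apply: ge_sup; first exact: spectrum_nonempty.
move=> _ [z /eigenvalue_real_dominates[t zt et] ->]; rewrite lerBrDr.
apply: (@le_trans _ _ (t + d%:R)); first by rewrite lerD2r.
have t0 : 0 <= t by apply: le_trans (normc_ge0 _) zt.
rewrite -[t + _]normc_nneg ?addr_ge0 //; apply: normc_le_spectral_radius.
rewrite QE eigenvalue_add_scalar rmorphD rmorph_nat addrK.
by rewrite -map_real_complex_nat eigenvalue_map.
Qed.

Lemma spectral_radius1 (R : realType) (Q : 'M[nat]_1) :
  spectral_radius R Q = (Q ord0 ord0)%:R.
Proof.
have -> : Q = \matrix_(i, j)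
    ((const_mx 0%N : 'M[nat]_1) i j + (i == j) * Q ord0 ord0)%N.
  by apply/matrixP => i j; rewrite !mxE !ord1 eqxx mul1n.
rewrite spectral_radius_add_scalar // !mxE eqxx mul1n add0n -[RHS]add0r.
congr (_ + _).
apply/eqP; rewrite eq_le spectral_radius_ge0 andbT.
apply: ge_sup; first exact: spectrum_nonempty.
move=> _ [z /eigenvalueP[v vQ v0] ->].
have [->|z0] := eqVneq z 0; first by rewrite Normc.normc0.
case/negP: v0; apply/eqP; apply: (scalerI z0); rewrite -vQ scaler0.
by apply/rowP => j; rewrite !mxE big1 // => i _; rewrite !mxE mulr0.
Qed.

(** * Local algebras *)

Section Eigenvector.
Import VectorInternalTheory.

Lemma lfun1_eq0 (k : fieldType) (V : vectType k) :
  (\1%VF == 0 :> 'End(V)) = (\dim {:V} == 0%N).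
Proof.
rewrite dimv_eq0; apply/eqP/eqP => V0; last first.
  by apply/lfunP => v; apply/eqP; rewrite id_lfunE zero_lfunE -memv0 -V0 memvf.
apply/eqP; rewrite -subv0; apply/subvP => v _.
by rewrite -[v]id_lfunE V0 zero_lfunE mem0v.
Qed.

Lemma closed_eigenvector (k : closedFieldType) (V : vectType k) (f : 'End(V)) :
  \1%VF != 0 :> 'End(V) -> exists a, exists2 v, v != 0 & f v = a *: v.
Proof.
rewrite lfun1_eq0 dimvf -lt0n => dV.
pose M := lin1_mx (v2r \o f \o r2v).
have /closed_rootP[a] : size (char_poly M) != 1%N.
  by rewrite size_char_poly eqSS -lt0n.
rewrite -eigenvalue_root_char => /eigenvalueP[v vM vN0].
exists a; exists (r2v v).
  by apply: contraNneq vN0 => /(congr1 v2r); rewrite r2vK linear0 => ->.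
by apply: v2r_inj; rewrite linearZ /= r2vK -vM mul_rV_lin1 /=.
Qed.

End Eigenvector.

(** * Units, right ideals and Nakayama's lemma *)

Section Falgebra.
Variables (k : fieldType) (B : falgType k).
Implicit Types (x y : B) (I J : {vspace B}).

(** Left multiplication by y is injective, hence onto by finite dimension; a preimage of 1 is a
    right inverse of y and so equals x. *)
Lemma falg_unitPr x y : x * y = 1 -> x \is a GRing.unit.
Proof.
move=> xy; have ky : lker (amull y) == 0%VS.
  apply/lker0P => u v; rewrite !lfunE /= => yuv.
  by rewrite -[u]mul1r -[v]mul1r -xy -!mulrA yuv.
have := memvf (1 : B); rewrite -(lker0_limgf ky) => /memv_imgP[w _].
rewrite lfunE /= => yw.
have wx : w = x by rewrite -[w]mul1r -xy -mulrA -yw mulr1.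
by apply/unitrP; exists y; rewrite xy yw wx.
Qed.

Lemma falg_unitPl x y : x * y = 1 -> y \is a GRing.unit.
Proof.
move=> xy; have /unitrP[z [zx xz]] := falg_unitPr xy.
have zy : z = y by rewrite -[z]mulr1 -xy mulrA zx mul1r.
by apply/unitrP; exists x; rewrite -zy zx.
Qed.

Lemma right_ideal_mul I x y : right_ideal I -> x \in I -> x * y \in I.
Proof. by move=> /prodvP rI xI; apply: rI; rewrite ?memvf. Qed.

Lemma right_ideal1 I : right_ideal I -> 1 \in I -> I = fullv.
Proof.
move=> rI I1; apply/vspaceP => x; rewrite memvf -[x]mul1r.
exact: right_ideal_mul.
Qed.

Lemma sub_maximal_right_ideal J : right_ideal J -> J <> fullv ->
  exists2 I, maximal_right_ideal I & (J <= I)%VS.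
Proof.
have [n] := ubnP (\dim {:B} - \dim J); elim: n J => // n IHn J Jn rJ JB.
have [maxJ|] := pselect (maximal_right_ideal J); first by exists J.
move=> /not_and3P[] // /existsNP[K] /not_implyP[rK] /not_implyP[JK].
move=> /not_orP[KJ KB].
have lt_dim : (\dim J < \dim K)%N.
  by rewrite (ltn_leqif (dimv_leqif_eq JK)); apply/eqP => /esym.
have le_dim : (\dim K <= \dim {:B})%N by apply/dimvS/subvf.
have [|I mI KI] := IHn K _ rK KB; last by exists I => //; apply: subv_trans KI.
by apply: leq_trans (ltn_sub2l (leq_trans lt_dim le_dim) lt_dim) _.
Qed.

(** Generators are removed one at a time. Since x lies in (<x> + <s>) I, there are i in I and w in
    <s> I with x (1 - i) = w; as 1 - i is a unit, x already lies in <s> I. *)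
Lemma nakayama_span I (s : seq B) :
    right_ideal I -> (forall x, x \in I -> 1 - x \is a GRing.unit) ->
    (<<s>> * fullv <= <<s>> * I)%VS -> (<<s>> * fullv = 0)%VS.
Proof.
move=> rI Iu; elim: s => [|x s IHs]; first by rewrite span_nil prod0v.
rewrite span_cons => sI.
have sIB (U : {vspace B}) : (U * I * fullv <= U * I)%VS.
  by rewrite -prodvA prodvSr.
have xI : x \in (<<s>> * I)%VS.
  have : x \in ((<[x]> + <<s>>) * I)%VS.
    apply: subvP sI _ _; rewrite -[x]mulr1 memv_mul ?memvf ?mulr1 //.
    by apply: subvP (addvSl _ _) _ _; apply: memv_line.
  rewrite prodvDl => /memv_addP[p px [w ws xE]].
  have /memv_imgP[i iI pE] : p \in (amull x @: I)%VS.
    suff /subvP : (<[x]> * I <= amull x @: I)%VS by apply.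
    apply/prodvP => _ b /vlineP[c ->] bI; apply/memv_imgP; exists (c *: b).
      exact: memvZ.
    by rewrite lfunE /= -scalerAl -scalerAr.
  rewrite lfunE /= in pE.
  have -> : x = w * (1 - i)^-1.
    have xw : x * (1 - i) = w.
      by rewrite mulrBr mulr1 -pE {1}xE addrAC subrr add0r.
    by rewrite -xw mulrK // Iu.
  by apply: (subvP (sIB _)); rewrite memv_mul ?memvf.
have sub_sI : ((<[x]> + <<s>>) * fullv <= <<s>> * I)%VS.
  apply: subv_trans sI _; rewrite prodvDl subv_add subvv andbT.
  apply: subv_trans (sIB _); apply: prodvS (subvf _).
  by rewrite -memvE.
have s0 : (<<s>> * fullv = 0)%VS.
  by apply: IHs; apply: subv_trans sub_sI; apply: prodvSl; apply: addvSr.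
apply/eqP; rewrite -subv0 -s0; apply: subv_trans sub_sI _.
by apply: prodvSr; apply: subvf.
Qed.

Lemma nakayama I J :
    right_ideal I -> (forall x, x \in I -> 1 - x \is a GRing.unit) ->
  right_ideal J -> (J <= J * I)%VS -> J = 0%VS.
Proof.
move=> rI Iu rJ JI; have sJ := span_basis (vbasisP J).
have := nakayama_span (s := vbasis J) rI Iu; rewrite sJ => J0.
apply/eqP; rewrite -subv0 -J0 ?(subv_trans rJ) //.
by apply/subvP => x xJ; rewrite -[x]mulr1 memv_mul ?memvf.
Qed.

(** By Nakayama the powers of I strictly decrease in dimension until they vanish. *)
Lemma right_ideal_nilpotent I :
    right_ideal I -> (forall x, x \in I -> 1 - x \is a GRing.unit) ->
  exists n, (I ^+ n = 0)%VS.
Proof.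
move=> rI Iu; exists (\dim I).+1; apply/eqP; rewrite -dimv_eq0.
suff dimI n : (\dim (I ^+ n.+1)%VS <= \dim I - n)%N.
  by rewrite -leqn0 (leq_trans (dimI _)) // subnn.
elim: n => [|n IHn]; first by rewrite subn0.
have [I0|I0] := eqVneq (I ^+ n.+1)%VS 0%VS.
  by rewrite expvSr I0 prod0v dimv0.
have rIn : right_ideal (I ^+ n.+1)%VS.
  by rewrite /right_ideal expvSr -prodvA prodvSr.
rewrite subnS -ltnS (leq_trans _ (leqSpred _)) // (leq_trans _ IHn) //.
have sI : (I ^+ n.+2 <= I ^+ n.+1)%VS.
  by rewrite expvSr; apply: subv_trans rIn; apply: prodvSr; apply: subvf.
rewrite (ltn_leqif (dimv_leqif_sup sI)); apply: contra I0 => In.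
by apply/eqP; apply: nakayama rI Iu rIn _; rewrite -expvSr.
Qed.

End Falgebra.

(** An element outside the unique maximal right ideal I generates the whole algebra, so it is a
    unit. This makes I two-sided with B = k + I, and [eps] is the projection onto k along I. *)
Lemma local_augmentation (k : closedFieldType) (B : falgType k) :
    local_algebra B ->
  exists eps : 'Hom(B, k^o), [/\ eps 1 = 1,
    forall x y, eps (x * y) = eps x * eps y & exists n, (lker eps ^+ n = 0)%VS].
Proof.
case=> I [[rI IB maxI] uniI].
have unitI x : x \notin I -> x \is a GRing.unit.
  move=> xI; have rJ : right_ideal (limg (amull x)).
    apply/prodvP => _ b /memv_imgP[c _ ->] _; apply/memv_imgP.
    by exists (c * b); rewrite ?memvf // !lfunE /= mulrA.
  have [JB|JB] := eqVneq (limg (amull x)) fullv.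
    have := memvf (1 : B); rewrite -JB => /memv_imgP[y _]; rewrite lfunE /=.
    by move/esym/falg_unitPr.
  have [K mK JK] := sub_maximal_right_ideal rJ (elimN eqP JB).
  case/negP: xI; rewrite (uniI K mK); apply: (subvP JK).
  by apply/memv_imgP; exists 1; rewrite ?memvf // lfunE /= mulr1.
have I1 : 1 \notin I by apply/negP => /(right_ideal1 rI).
have Iunit x : x \in I -> x \isn't a GRing.unit.
  move=> xI; apply: contra I1 => ux; rewrite -(mulrV ux).
  exact: right_ideal_mul.
(* If x y were outside I it would be a unit, so y would be left invertible and hence a unit. *)
have IlB x y : y \in I -> x * y \in I.
  move=> yI; apply: contraT => /unitI/mulVr; rewrite mulrA => /falg_unitPl.
  by rewrite (negPf (Iunit _ yI)).
(* The scalar is an eigenvalue of left multiplication by x: then x - a kills a nonzero vector, so it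
   is not a unit and lies in I. *)
have exE x : exists a, x - a%:A \in I.
  have [|a [v v0 xv]] := closed_eigenvector (amull x).
    by apply/lfunPn; exists 1; rewrite !lfunE oner_neq0.
  exists a; apply: contraT => /unitI/mulVr E.
  case/eqP: v0; rewrite -[v]mul1r -E -mulrA mulrBl -scalerAl mul1r.
  by move: xv; rewrite lfunE /= => ->; rewrite subrr mulr0.
pose e x : k^o := projT1 (cid (exE x)).
have eP x : x - (e x)%:A \in I by rewrite /e; case: cid.
have eE x (a : k) : x - a%:A \in I -> e x = a.
  move=> xa; apply/eqP; apply: contraNT I1; rewrite -subr_eq0 => ea.
  have : (e x - a)%:A \in I.
    rewrite scalerBl; have := rpredB xa (eP x).
    by rewrite opprB addrC addrA subrK.
  by move/(memvZ (e x - a)^-1); rewrite scalerA mulVf // scale1r.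
have eL : linear e.
  move=> c x y; apply: eE.
  have := rpredD (memvZ c (eP x)) (eP y); rewrite scalerBr scalerA addrACA.
  by rewrite -opprD -scalerDl.
exists (linfun e : 'Hom(B, k^o)); split.
- by rewrite linfunE //; apply: eE; rewrite scale1r subrr mem0v.
- move=> x y; rewrite !linfunE //; apply: eE.
  rewrite (_ : _ - _ = (x - (e x)%:A) * y + (e x)%:A * (y - (e y)%:A)).
    by apply: rpredD; [apply: right_ideal_mul | apply: IlB].
  by rewrite mulrBl mulrBr -!scalerAl !mul1r scalerA addrA subrK.
have -> : lker (linfun e : 'Hom(B, k^o)) = I.
  apply/vspaceP => x; rewrite memv_ker linfunE //; apply/eqP/idP => [e0|xI].
    by have := eP x; rewrite e0 scale0r subr0.
  by apply: eE; rewrite scale0r subr0.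
apply: right_ideal_nilpotent => // x xI; apply: unitI.
by apply: contra I1 => /(rpredD xI); rewrite addrC subrK.
Qed.

(** * Ext^1 and crossed homomorphisms *)

(** A subspace of largest dimension inside P contains every v satisfying P, since adding the line of
    v stays inside P. *)
Lemma vspace_comprehension (k : fieldType) (V : vectType k) (P : V -> Prop) :
    P 0 -> (forall c u v, P u -> P v -> P (c *: u + v)) ->
  exists U : {vspace V}, forall v, v \in U <-> P v.
Proof.
move=> P0 PL; pose Q n := `[< exists2 U : {vspace V}, \dim U = n &
  forall v, v \in U -> P v >].
have exQ : exists n, Q n.
  exists 0%N; apply/asboolP; exists 0%VS; rewrite ?dimv0 // => v.
  by rewrite memv0 => /eqP ->.
have ubQ n : Q n -> (n <= \dim {:V})%N.
  by move/asboolP => [U <- _]; apply/dimvS/subvf.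
case: (ex_maxnP exQ ubQ) => n /asboolP[U Un UP] nmax.
exists U => v; split=> [|Pv]; first exact: UP.
have /eqP -> : U == (U + <[v]>)%VS; last first.
  by apply: subvP (addvSr _ _) _ _; apply: memv_line.
rewrite eqEdim addvSl Un; apply: nmax; apply/asboolP.
exists (U + <[v]>)%VS => // _ /memv_addP[u uU [_ /vlineP[c ->] ->]].
by rewrite addrC; apply: PL => //; apply: UP.
Qed.

Lemma linear_at0 (k : fieldType) (U V : lmodType k) (f : U -> V) :
  linear f -> f 0 = 0.
Proof.
by move=> fL; have := fL (-1) 0 0; rewrite scaler0 addr0 scaleN1r addNr.
Qed.

Lemma linear_atD (k : fieldType) (U V : lmodType k) (f : U -> V) u v :
  linear f -> f (u + v) = f u + f v.
Proof. by move=> fL; have := fL 1 u v; rewrite !scale1r. Qed.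

Lemma linfun2E (k : fieldType) (U V W : vectType k) (h : U -> V -> W) :
    (forall u, linear (h u)) -> (forall v, linear (h^~ v)) ->
  forall u v, linfun (fun u => linfun (h u) : 'Hom(V, W)) u v = h u v.
Proof.
move=> hl hr u v; rewrite (linfunE (f := fun u => linfun (h u))) ?linfunE //.
move=> c x y; apply/lfunP => w.
by rewrite add_lfunE scale_lfunE !linfunE // hr.
Qed.

Lemma dim_limg_inj (k : fieldType) (U V : vectType k) (f : 'Hom(U, V))
    (X : {vspace U}) :
  (forall u, u \in X -> f u = 0 -> u = 0) -> \dim (f @: X) = \dim X.
Proof.
move=> fX; apply: limg_dim_eq; apply/eqP; rewrite -subv0.
apply/subvP => u; rewrite memv_cap memv_ker memv0 => /andP[uX /eqP fu].
by rewrite (fX u).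
Qed.

Local Notation cover := Defs.cover.

Section Ext1.
Variables (k : fieldType) (A : falgType k).
Implicit Types M N : rmod A.

Lemma ractDl M (m n : M) a : ract (m + n) a = ract m a + ract n a.
Proof. by have := ract_linl a 1 m n; rewrite !scale1r. Qed.

Lemma ractDr M (m : M) a b : ract m (a + b) = ract m a + ract m b.
Proof. by have := ract_linr m 1 a b; rewrite !scale1r. Qed.

Lemma ractr0 M (m : M) : ract m 0 = 0.
Proof. by apply: (addIr (ract m 0)); rewrite -ractDr !add0r. Qed.

Lemma ractZl M c (m : M) a : ract (c *: m) a = c *: ract m a.
Proof. by have := ract_linl a c m 0; rewrite ract0 !addr0. Qed.

Lemma ractZr M c (m : M) a : ract m (c *: a) = c *: ract m a.
Proof. by have := ract_linr m c a 0; rewrite ractr0 !addr0. Qed.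

Lemma ractN M (m : M) a : ract (- m) a = - ract m a.
Proof. by rewrite -scaleN1r ractZl scaleN1r. Qed.

Lemma homA_comp M N (P : rmod A) (f : 'Hom(M, N)) (g : 'Hom(N, P)) :
  f \in homA M N -> g \in homA N P -> (g \o f)%VF \in homA M P.
Proof.
by move=> /homAP fA /homAP gA; apply/homAP => m a; rewrite !comp_lfunE fA gA.
Qed.

Lemma cover_map_surj M (m : M) : exists t, cover_map M t = m.
Proof. by exists (tens m 1); rewrite cover_mapE ract1. Qed.

Lemma cover_map_hom_inj M N (g : 'Hom(M, N)) :
  (g \o cover_map M)%VF = 0 -> g = 0.
Proof.
move=> g0; apply/lfunP => m; have [t <-] := cover_map_surj m.
by rewrite -comp_lfunE g0 !zero_lfunE.
Qed.

(** Left exactness of Hom(-, N) on P_1 -> P_0 -> M -> 0. Applied to [syz M] in place of M, it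
    identifies the 1-cocycles with Hom_A(syz M, N). *)
Lemma homA_cover_factor M N :
  (homA (res M 0) N :&: lker (linfun (fun f => f \o res_d M 0)%VF) =
   linfun (fun g : 'Hom(M, N) => g \o cover_map M)%VF @: homA M N)%VS.
Proof.
apply/vspaceP => f; rewrite memv_cap [X in _ && X]memv_ker.
rewrite (linfunE (@comp_lfun_linear _ _ _ _ _)).
apply/andP/memv_imgP => [[fA /eqP fd0]|[g gA ->]]; last first.
  rewrite (linfunE (@comp_lfun_linear _ _ _ _ _)); split.
    exact: homA_comp (cover_map_hom M) gA.
  apply/eqP/lfunP => t; rewrite !comp_lfunE zero_lfunE.
  by have /= -> := cover_map_incl (cover_map (syz M) t); rewrite linear0.
have f0 (t : cover M) : t \in lker (cover_map M) -> f t = 0.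
  rewrite -limg_syz_incl => /memv_imgP[u _ ->]; have [w <-] := cover_map_surj u.
  have := congr1 (fun h : 'Hom(_, _) => h w) fd0.
  by rewrite !comp_lfunE zero_lfunE.
(* The element m (x) a - m a (x) 1 lies in the kernel of the cover. *)
have fE m a : f (tens m a) = f (tens (ract m a) 1).
  apply/eqP; rewrite -subr_eq0 -linearB /=; apply/eqP/f0.
  by rewrite memv_ker linearB /= !cover_mapE ract1 subrr.
pose g : 'Hom(M, N) := linfun (fun m : M => f (tens m 1)).
have gE m : g m = f (tens m 1).
  by rewrite linfunE // => c x y; rewrite tens_linl linearP.
have gA : g \in homA M N.
  apply/homAP => m a; rewrite !gE -fE -(homAP _ fA).
  by rewrite /= cover_actE mul1r.
exists g => //; rewrite (linfunE (@comp_lfun_linear _ _ _ _ _)).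
apply: cover_hom_ext => // [|m]; first exact: homA_comp (cover_map_hom M) gA.
by rewrite comp_lfunE cover_mapE gE ract1.
Qed.

Lemma dim_homA_cover M N : \dim (homA (cover M) N) = \dim {: 'Hom(M, N)}.
Proof.
pose ev (f : 'Hom(cover M, N)) : 'Hom(M, N) :=
  linfun (fun m : M => f (tens m 1)).
have evE f m : ev f m = f (tens m 1).
  by rewrite linfunE // => c x y; rewrite tens_linl linearP.
have evL : linear ev.
  by move=> c f g; apply/lfunP => m; rewrite !(evE, add_lfunE, scale_lfunE).
rewrite -(@dim_limg_inj _ _ _ (linfun ev)) => [|f fA].
  congr (\dim _); apply/vspaceP => g; rewrite memvf; apply/memv_imgP.
  have [f fA fg] := cover_free g; exists f => //.
  by rewrite linfunE //; apply/lfunP => m; rewrite evE fg.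
rewrite linfunE // => f0; apply: cover_hom_ext => // [|m]; first exact: mem0v.
by rewrite -evE f0 !zero_lfunE.
Qed.

(** This is what makes (n, m) a = (n a + D a m, m a) associative on the direct sum of N and M: D is
    an extension of M by N together with a linear splitting. *)
Definition is_crossed M N (D : 'Hom(A, 'Hom(M, N))) : Prop := forall a b m,
  D (a * b) m = ract (D a m) b + D b (ract m a).

Lemma crossed_subspace M N :
  exists U : {vspace 'Hom(A, 'Hom(M, N))}, forall D, D \in U <-> is_crossed D.
Proof.
apply: vspace_comprehension => [a b m|c u v uA vA a b m].
  by rewrite !zero_lfunE ract0 addr0.
rewrite !(add_lfunE, scale_lfunE) uA vA ractDl ractZl.
by rewrite scalerDr addrACA.
Qed.

(* The bar-complex cocycles Z^1(A, Hom_k(M, N)). *)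
Definition crossed M N : {vspace 'Hom(A, 'Hom(M, N))} :=
  projT1 (cid (crossed_subspace M N)).

Lemma crossedP M N (D : 'Hom(A, 'Hom(M, N))) :
  reflect (is_crossed D) (D \in crossed M N).
Proof. by rewrite /crossed; case: cid => U UP; apply: (iffP idP) => /UP. Qed.

Lemma crossed1 M N (D : 'Hom(A, 'Hom(M, N))) m : is_crossed D -> D 1 m = 0.
Proof.
by move=> /(_ 1 1 m); rewrite mulr1 !ract1 => /(canLR (addrK _)); rewrite subrr.
Qed.

(* D and f : syz M -> N correspond by D a m = f (m (x) a - m a (x) 1). *)
Lemma dim_homA_syz M N : \dim (homA (syz M) N) = \dim (crossed M N).
Proof.
pose T (D : 'Hom(A, 'Hom(M, N))) := tlift (fun (m : M) a => D a m).
have TE D m a : T D (tens m a) = D a m.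
  by rewrite /T tliftE // => ? c x y; rewrite linearP // add_lfunE scale_lfunE.
have TD D s t : T D (s + t) = T D s + T D t by apply: linearD.
pose F D : 'Hom(syz M, N) := linfun (fun u : syz M => T D (vsval u)).
have FE D u : F D u = T D (vsval u).
  by rewrite linfunE // => c x y; rewrite linearP; apply: tlift_linear.
have FL : linear F.
  move=> c D D'; apply/lfunP => u; rewrite add_lfunE scale_lfunE !FE.
  by apply: tlift_comb => m a; rewrite !(add_lfunE, scale_lfunE).
have T0 D : T D 0 = 0 by apply: linear0.
have tens01 : tens (0 : M) (1 : A) = 0 by rewrite (linear_at0 (tens_linl 1)).
(* The linear projection of the cover onto the syzygy along M (x) 1. *)
pose q (t : cover M) : syz M :=
  vsproj (lker (cover_map M)) (t - tens (cover_map M t) 1).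
have qE t : vsval (q t) = t - tens (cover_map M t) 1.
  by apply: vsprojK; rewrite memv_ker linearB /= cover_mapE ract1 subrr.
have qL : linear q.
  move=> c s t; apply: subvs_inj; rewrite linearP /= !qE linearP tens_linl.
  by rewrite opprD scalerBr addrACA.
have qD s t : q (s + t) = q s + q t by apply: linear_atD.
have q0 : q 0 = 0 by apply: linear_at0.
have actE (m : M) a b : ract (tens m a - tens (ract m a) 1 : cover M) b =
    tens m (a * b) - tens (ract m a) b.
  by rewrite ractDl ractN /= !cover_actE mul1r.
rewrite -(@dim_limg_inj _ _ _ (linfun F)) => [|D /crossedP DA].
  congr (\dim _); apply/vspaceP => f.
  apply/idP/memv_imgP => [fA|[D /crossedP DA ->]].
    pose D : 'Hom(A, 'Hom(M, N)) :=
      linfun (fun a => linfun (fun m : M => f (q (tens m a)))).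
    have DE a m : D a m = f (q (tens m a)).
      apply: (linfun2E (h := fun a (m : M) => f (q (tens m a)))) => [b|n] c x y.
        by rewrite tens_linl qL linearP.
      by rewrite tens_linr qL linearP.
    exists D.
      apply/crossedP => a b m; rewrite !DE -(homAP _ fA) -linearD /=.
      congr (f _).
      apply: subvs_inj; rewrite linearD /= syz_actE !qE !cover_mapE ractM.
      by rewrite actE addrA subrK.
    rewrite linfunE //; apply/lfunP => u; rewrite FE.
    have TfE t : T D t = f (q t).
      elim/tens_ind: t => [|s t ss tt|m a]; last by rewrite TE DE.
        by rewrite T0 q0 linear0.
      by rewrite TD qD linearD ss tt.
    rewrite TfE; congr (f _); apply: subvs_inj; rewrite qE.
    have /eqP -> : cover_map M (vsval u) == 0 by rewrite -memv_ker subvsP.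
    by rewrite tens01 subr0.
  rewrite linfunE //; apply/homAP => u b; rewrite !FE syz_actE.
  (* On the whole cover [T D] fails to be A-linear by a term that depends only on the image in M, so
     it is A-linear on the syzygy. *)
  have TA t : T D (@ract _ _ (cover M) t b) =
      ract (T D t) b + D b (cover_map M t).
    elim/tens_ind: t => [|s t ss tt|m a].
    - by rewrite ract0 T0 ract0 !linear0 addr0.
    - by rewrite ractDl !TD ss tt ractDl !linearD /= addrACA.
    - by rewrite /= cover_actE !TE cover_mapE DA.
  have /eqP u0 : cover_map M (vsval u) == 0 by rewrite -memv_ker subvsP.
  by rewrite TA u0 linear0 addr0.
(* Injectivity: D a m is recovered as the value of [F D] at q (m (x) a), because D 1 = 0. *)
rewrite linfunE // => FD0; apply/lfunP => a; apply/lfunP => m.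
have := congr1 (fun g : 'Hom(syz M, N) => g (q (tens m a))) FD0.
rewrite FE qE cover_mapE !zero_lfunE => <-.
have TB s t : T D (s - t) = T D s - T D t by apply: linearB.
by rewrite TB !TE crossed1 // subr0.
Qed.

(** The Euler characteristic of 0 -> Hom_A(M, N) -> Hom_k(M, N) -> Z^1 -> Ext^1 -> 0, where Hom_k(M,
    N) stands for Hom_A(P_0, N). The additive form avoids truncated subtraction. *)
Lemma dim_ext1E M N :
  (dim_ext1 M N + \dim {: 'Hom(M, N)} = \dim (crossed M N) + \dim (homA M N))%N.
Proof.
have dimF M' : \dim (homA M' N) =
    \dim (linfun (fun g : 'Hom(M', N) => g \o cover_map M')%VF @: homA M' N).
  apply/esym/dim_limg_inj => g _.
  rewrite (linfunE (@comp_lfun_linear _ _ _ _ _)).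
  exact: cover_map_hom_inj.
have dZ : \dim (ext1_cocycles M N) = \dim (crossed M N).
  by rewrite -dim_homA_syz dimF -homA_cover_factor.
pose d0 := linfun (fun f : 'Hom(res M 0, N) => f \o res_d M 0)%VF.
have := limg_ker_dim d0 (homA (res M 0) N).
rewrite homA_cover_factor -dimF -[X in (_ + \dim X)%N]/(ext1_coboundaries M N).
rewrite dim_homA_cover => <-.
rewrite /dim_ext1 -dZ addnA addnAC subnK // dimvS //.
exact: ext1_coboundaries_sub.
Qed.

End Ext1.

(** * Bricks over an augmented algebra *)

Section Pullback.
Variables (k : fieldType) (C D : falgType k) (f : 'Hom(C, D)).
Hypotheses (f1 : f 1 = 1) (fM : forall x y, f (x * y) = f x * f y).

Section Module.
Variable M : rmod D.
Definition pullback_act (m : M) (c : C) : M := ract m (f c).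

Fact pullback_act_linl c : linear (pullback_act^~ c).
Proof. exact: ract_linl. Qed.

Fact pullback_act_linr m : linear (pullback_act m).
Proof. by move=> a x y; rewrite /pullback_act linearP ract_linr. Qed.

Fact pullback_act1 m : pullback_act m 1 = m.
Proof. by rewrite /pullback_act f1 ract1. Qed.

Fact pullback_actM m x y :
  pullback_act m (x * y) = pullback_act (pullback_act m x) y.
Proof. by rewrite /pullback_act fM ractM. Qed.

Definition pullback : rmod C :=
  RMod pullback_act_linl pullback_act_linr pullback_act1 pullback_actM.
End Module.

Lemma homA_pullback (M N : rmod D) : (forall d, exists c, f c = d) ->
  homA (pullback M) (pullback N) = homA M N :> {vspace 'Hom(M, N)}.
Proof.
move=> fsurj; apply/vspaceP => g.
apply/(@homAP _ _ (pullback M) (pullback N))/homAP => gA m a; last exact: gA.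
by have [c <-] := fsurj a; apply: gA.
Qed.

End Pullback.

(** Literal equality of modules, rather than isomorphism, lets a semibrick be replaced by a family
    of inflations without transporting Hom and Ext. *)
Lemma rmod_ext (k : fieldType) (A : falgType k) (V : vectType k)
    (act act' : V -> A -> V) p1 p2 p3 p4 p1' p2' p3' p4' : act =2 act' ->
  @RMod k A V act p1 p2 p3 p4 = @RMod k A V act' p1' p2' p3' p4'.
Proof.
move=> actE; have {}actE : act = act' by apply: funext => v; apply: funext => a.
rewrite actE in p1 p2 p3 p4 *.
by congr (RMod _ _ _ _); apply: Prop_irrelevance.
Qed.

Section BrickClosed.
Variables (k : closedFieldType) (A : falgType k).

(** Schur's lemma: if a is an eigenvalue of f, then f - a is an endomorphism that is not injective,
    hence zero. *)
Lemma brick_homA (M : rmod A) : brick M -> homA M M = <[\1%VF]>%VS.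
Proof.
case=> M0 Minv; apply/vspaceP => f; apply/idP/vlineP => [fA|[a ->]]; last first.
  by apply: memvZ; apply/homAP => m a'; rewrite !id_lfunE.
have [a [v v0 fv]] := closed_eigenvector f M0.
exists a; apply/eqP; rewrite -subr_eq0; apply: contraT => fa0.
have hA : f - a *: \1%VF \in homA M M.
  by apply: rpredB => //; apply/memvZ/homAP => m b; rewrite !id_lfunE.
have [g [_ gf _]] := Minv _ hA fa0.
case/eqP: v0; have := congr1 (fun h : 'End(M) => h v) gf.
rewrite comp_lfunE id_lfunE => <-.
by rewrite add_lfunE opp_lfunE scale_lfunE id_lfunE fv subrr linear0.
Qed.

End BrickClosed.

Section Augmented.
Variables (k : fieldType) (B : falgType k) (eps : 'Hom(B, k^o)).
Hypotheses (eps1 : eps 1 = 1) (epsM : forall x y, eps (x * y) = eps x * eps y).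
Hypothesis eps_nil : exists n, (lker eps ^+ n = 0)%VS.
Local Notation I := (lker eps).

Lemma eps_ker x : eps (x - (eps x)%:A) = 0.
Proof. by rewrite linearB linearZ /= eps1 -[_ *: 1]/(_ * 1) mulr1 subrr. Qed.

(* The span hypothesis says that C is spanned by the products of j(B) with its
   centraliser.  If I^(n+1) kills M, then I^n acts by endomorphisms of M of
   square zero as long as n > 0. *)
Lemma brick_augmentation_ideal (C : falgType k) (j : 'Hom(B, C))
    (M : rmod C) :
    (forall x y, j (x * y) = j x * j y) ->
    (forall P : C -> Prop, P 0 -> (forall s t, P s -> P t -> P (s + t)) ->
       (forall c b, (forall b', c * j b' = j b' * c) -> P (c * j b)) ->
       forall x, P x) ->
  brick M -> forall (m : M) b, eps b = 0 -> ract m (j b) = 0.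
Proof.
move=> jM Cspan [_ Minv].
pose P n := forall b, b \in (I ^+ n)%VS -> forall m : M, ract m (j b) = 0.
have step n : P n.+2 -> P n.+1.
  move=> Pn b bI m.
  have fL : linear (fun m : M => ract m (j b)) by apply: ract_linl.
  set f : 'End(M) := linfun (fun m : M => ract m (j b)).
  have fE u : f u = ract u (j b) by rewrite linfunE.
  have fA : f \in homA M M.
    apply/homAP => u x; rewrite !fE -!ractM; move: x.
    apply: Cspan => [|s t Es Et|c b' cB]; first by rewrite mul0r mulr0.
      by rewrite mulrDl mulrDr !ractDr Es Et.
    rewrite mulrA -cB -!mulrA -!jM !ractM.
    apply/eqP; rewrite -subr_eq0 -scaleN1r -ractZr -ractDr scaleN1r -linearB /=.
    (* Scalars are central, so b' may be replaced by its component r in I; both r b and b r then lie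
       in I^(n+2), which kills M. *)
    set r := b' - (eps b')%:A; have rI : r \in I by rewrite memv_ker eps_ker.
    have -> : b' * b - b * b' = r * b - b * r.
      rewrite /r mulrBl mulrBr -scalerAl -scalerAr mul1r mulr1.
      by rewrite opprB addrA subrK.
    rewrite Pn //; apply: rpredB.
      by rewrite expvSl memv_mul.
    by rewrite expvSr memv_mul.
  have ff u : f (f u) = 0.
    rewrite !fE -ractM -jM Pn // expvSl memv_mul // memv_ker.
    suff /subvP/(_ b bI) : (I ^+ n.+1 <= I)%VS by rewrite memv_ker.
    rewrite expvSl; apply/prodvP => x y; rewrite !memv_ker => /eqP x0 _.
    by rewrite epsM x0 mul0r.
  rewrite -fE; have [->|f0] := eqVneq f 0; first by rewrite zero_lfunE.
  have [g [_ gf _]] := Minv _ fA f0.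
  have := congr1 (fun h : 'End(M) => h (f m)) gf.
  by rewrite comp_lfunE ff linear0 id_lfunE => <-.
have P1 : P 1%N.
  have [n nI] := eps_nil.
  (* One power more than nilpotency provides, so that the descent to P 1 starts at a positive
     exponent even when n = 0. *)
  have : P n.+1.
    move=> b; rewrite expvSr nI prod0v memv0 => /eqP -> m.
    by rewrite linear0 ractr0.
  by elim: n {nI} => // n IHn /step.
by move=> m b b0; apply: P1; rewrite expv1 memv_ker b0.
Qed.

(** Point derivations of B at [eps]; they form the dual of I / I^2. *)
Definition is_derivation (d : 'Hom(B, k^o)) : Prop :=
  forall x y, d (x * y) = d x * eps y + eps x * d y.

Lemma derivations_subspace :
  exists U : {vspace 'Hom(B, k^o)}, forall d, d \in U <-> is_derivation d.
Proof.
apply: vspace_comprehension => [x y|c u v uD vD x y].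
  by rewrite !zero_lfunE mul0r mulr0 addr0.
rewrite !(add_lfunE, scale_lfunE) uD vD mulrDl mulrDr scalerDr addrACA.
by rewrite -scalerAl -scalerAr.
Qed.

Definition derivations : {vspace 'Hom(B, k^o)} :=
  projT1 (cid derivations_subspace).

Lemma derivationsP d : reflect (is_derivation d) (d \in derivations).
Proof.
by rewrite /derivations; case: cid => U UP; apply: (iffP idP) => /UP.
Qed.

Lemma derivation1 d : is_derivation d -> d 1 = 0.
Proof.
move=> /(_ 1 1); rewrite mulr1 eps1 mulr1 mul1r => /(canLR (addrK _)).
by rewrite subrr.
Qed.

Lemma scalar_family (V : vectType k) (E : 'Hom(B, 'End(V))) :
    \1%VF != 0 :> 'End(V) -> (forall b, E b \in <[\1%VF]>%VS) ->
  exists d : 'Hom(B, k^o), forall b, E b = d b *: \1%VF.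
Proof.
move=> V0 EV.
have exd b : exists a, E b = a *: \1%VF by apply/vlineP.
pose d b : k^o := projT1 (cid (exd b)).
have dE b : E b = d b *: \1%VF by rewrite /d; case: cid.
have dL : linear d.
  move=> c x y; apply/eqP; rewrite -subr_eq0; apply: contraNT V0 => /negPf d0.
  have : (d (c *: x + y) - (c *: d x + d y)) *: (\1%VF : 'End(V)) = 0.
    rewrite scalerBl scalerDl -[c *: d x]/(c * d x) -scalerA -!dE.
    by rewrite linearP subrr.
  by move/eqP; rewrite scaler_eq0 d0.
by exists (linfun d) => b; rewrite linfunE.
Qed.

End Augmented.

(** * Inflation to a tensor product *)

Section Tensor.
Variables (k : fieldType) (A B : falgType k) (eps : 'Hom(B, k^o)).
Hypotheses (eps1 : eps 1 = 1) (epsM : forall x y, eps (x * y) = eps x * eps y).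
Local Notation T := (A \tensor B).

Definition tens_inl : 'Hom(A, T) := linfun (fun a => tens a 1 : T).
Definition tens_inr : 'Hom(B, T) := linfun (fun b => tens 1 b : T).

Lemma tens_inlE a : tens_inl a = tens a 1.
Proof. by rewrite linfunE //; apply: tens_linl. Qed.

Lemma tens_inrE b : tens_inr b = tens 1 b.
Proof. by rewrite linfunE //; apply: tens_linr. Qed.

Lemma tens_inl1 : tens_inl 1 = 1.
Proof. exact: tens_inlE. Qed.

Lemma tens_inlM x y : tens_inl (x * y) = tens_inl x * tens_inl y.
Proof. by rewrite !tens_inlE tens_mul mulr1. Qed.

Lemma tens_inrM x y : tens_inr (x * y) = tens_inr x * tens_inr y.
Proof. by rewrite !tens_inrE tens_mul mulr1. Qed.

Lemma tens_inlr a b : tens_inl a * tens_inr b = tens a b.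
Proof. by rewrite tens_inlE tens_inrE tens_mul mulr1 mul1r. Qed.

Lemma tens_inrl a b : tens_inr b * tens_inl a = tens a b.
Proof. by rewrite tens_inlE tens_inrE tens_mul mulr1 mul1r. Qed.

(* [contract eps] is the projection of A (x) B onto A; a derivation d of B
   gives a derivation [contract d] from A (x) B to A. *)
Definition contract (d : 'Hom(B, k^o)) : 'Hom(T, A) :=
  linfun (tlift (fun a b => (d b : k) *: a)).

Lemma contractE d a b : contract d (tens a b) = (d b : k) *: a.
Proof.
rewrite linfunE; last exact: tlift_linear.
rewrite tliftE // => [w|v] c x y; first by rewrite scalerDr !scalerA mulrC.
by rewrite linearP scalerDl scalerA.
Qed.

Lemma contract_derivation d x y : is_derivation eps d ->
  contract d (x * y) =
    contract d x * contract eps y + contract eps x * contract d y.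
Proof.
move=> dD; elim/tens_ind: x => [|s t ss tt|a b].
- by rewrite mul0r !linear0 !mul0r addr0.
- by rewrite mulrDl !linearD /= ss tt !mulrDl addrACA.
elim/tens_ind: y => [|s t ss tt|a' b'].
- by rewrite mulr0 !linear0 !mulr0 addr0.
- by rewrite mulrDr !linearD /= ss tt !mulrDr addrACA.
rewrite tens_mul !contractE dD -!scalerAl -!scalerAr !scalerA.
by rewrite scalerDl.
Qed.

Local Notation pi := (contract eps).

Lemma contract1 : pi 1 = 1.
Proof. by rewrite contractE eps1 scale1r. Qed.

Lemma contractM x y : pi (x * y) = pi x * pi y.
Proof.
elim/tens_ind: x => [|s t ss tt|a b]; first by rewrite mul0r linear0 mul0r.
  by rewrite mulrDl !linearD /= ss tt mulrDl.
elim/tens_ind: y => [|s t ss tt|a' b']; first by rewrite mulr0 linear0 mulr0.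
  by rewrite mulrDr !linearD /= ss tt mulrDr.
by rewrite tens_mul !contractE epsM -scalerAl -scalerAr scalerA.
Qed.

Lemma contract_inl a : pi (tens_inl a) = a.
Proof. by rewrite tens_inlE contractE eps1 scale1r. Qed.

Definition inflation (M : rmod A) : rmod T := pullback contract1 contractM M.

Lemma homA_inflation (M N : rmod A) :
  homA (inflation M) (inflation N) = homA M N :> {vspace 'Hom(M, N)}.
Proof.
by apply: homA_pullback => a; exists (tens_inl a); apply: contract_inl.
Qed.

(** Writing b as (b - eps b) + eps b, the first summand acts by zero, so a (x) b acts as eps(b)
    a. *)
Lemma inflation_restriction (M : rmod T) :
    (forall (m : M) b, eps b = 0 -> ract m (tens_inr b) = 0) ->
  inflation (pullback tens_inl1 tens_inlM M) = M.
Proof.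
move=> M0; suff : forall (m : M) x, ract m (tens_inl (pi x)) = ract m x.
  case: M {M0} => V act p1 p2 p3 p4 /= actE; exact: rmod_ext.
move=> m; apply: tens_ind => [|s t ss tt|a b]; first by rewrite !linear0.
  by rewrite !linearD /= !ractDr ss tt.
rewrite contractE linearZ /= ractZr -tens_inlr ractM.
rewrite -{2}[b](subrK (eps b)%:A) linearD ractDr /= M0 ?eps_ker // add0r.
by rewrite linearZ /= ractZr [tens_inr 1]tens_inrE -[tens 1 1]/(1 : T) ract1.
Qed.

(** The span hypothesis of [brick_augmentation_ideal] for A (x) B: the elements a (x) 1 centralise 1
    (x) B. *)
Lemma tens_span (P : T -> Prop) :
    P 0 -> (forall s t, P s -> P t -> P (s + t)) ->
    (forall c b, (forall b', c * tens_inr b' = tens_inr b' * c) ->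
       P (c * tens_inr b)) ->
  forall x, P x.
Proof.
move=> P0 PD Pc; apply: tens_ind => // a b; rewrite -tens_inlr; apply: Pc => b'.
by rewrite tens_inlr tens_inrl.
Qed.

Section Crossed.
Variables M N : rmod A.
Local Notation M' := (inflation M).
Local Notation N' := (inflation N).

(* Isomorphic to Hom_A(M, N) (x) Der_eps(B, k), via D (1 (x) b). *)
Definition crossed_ker : {vspace 'Hom(T, 'Hom(M, N))} :=
  (crossed M' N' :&: lker (linfun (fun D => D \o tens_inl)%VF))%VS.

Lemma crossed_kerP (D : 'Hom(T, 'Hom(M, N))) :
  reflect (@is_crossed _ _ M' N' D /\ forall a, D (tens_inl a) = 0)
    (D \in crossed_ker).
Proof.
rewrite memv_cap [X in _ && X]memv_ker (linfunE (@comp_lfun_linear _ _ _ _ _)).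
apply: (iffP andP) => -[/(@crossedP _ _ M' N') Dc D0]; split=> //.
  by move=> a; rewrite -comp_lfunE (eqP D0) zero_lfunE.
by apply/eqP; apply/lfunP => a; rewrite comp_lfunE D0 zero_lfunE.
Qed.

(** Rank-nullity for restriction along A -> A (x) B, which is onto because composition with [pi]
    splits it. *)
Lemma dim_crossed_inflation :
  \dim (crossed M' N') = (\dim (crossed M N) + \dim crossed_ker)%N.
Proof.
pose F := linfun (fun D : 'Hom(T, 'Hom(M', N')) => D \o tens_inl)%VF.
rewrite -(limg_ker_dim F).
rewrite addnC; congr (\dim _ + _)%N; apply/vspaceP => D.
apply/memv_imgP/crossedP => [[D' /crossedP D'c ->] a b m|Dc].
  rewrite (linfunE (@comp_lfun_linear _ _ _ _ _)) !comp_lfunE tens_inlM D'c /=.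
  by rewrite /pullback_act !contract_inl.
exists (D \o pi)%VF.
  by apply/crossedP => x y m; rewrite !comp_lfunE contractM Dc.
rewrite (linfunE (@comp_lfun_linear _ _ _ _ _)); apply/lfunP => a.
by rewrite !comp_lfunE contract_inl.
Qed.

Lemma dim_ext1_inflation : dim_ext1 M' N' = (dim_ext1 M N + \dim crossed_ker)%N.
Proof.
have := dim_ext1E M' N'; rewrite dim_crossed_inflation homA_inflation.
by rewrite addnAC -dim_ext1E addnAC => /addIn.
Qed.

Lemma crossed_ker_tens D a b m : D \in crossed_ker ->
  D (tens a b) m = D (tens_inr b) (ract m a).
Proof.
case/crossed_kerP => Dc D0; rewrite -tens_inlr Dc D0 zero_lfunE ract0 add0r.
by rewrite /= /pullback_act contract_inl.
Qed.

(** D vanishes on A, so expanding D (a (x) b) by the two factorisations of a (x) b gives D (1 (x) b)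
    (m a) on one side and (D (1 (x) b) m) a on the other. *)
Lemma crossed_ker_homA D b : D \in crossed_ker -> D (tens_inr b) \in homA M N.
Proof.
move=> DK; apply/homAP => m a; rewrite -crossed_ker_tens // -tens_inrl.
case/crossed_kerP: DK => -> D0.
by rewrite D0 zero_lfunE addr0 /= /pullback_act contract_inl.
Qed.

Lemma crossed_ker0 : homA M N = 0%VS -> crossed_ker = 0%VS.
Proof.
move=> H0; apply/eqP; rewrite -subv0; apply/subvP => D DK; rewrite memv0.
apply/eqP/lfunP; apply: tens_ind => [|s t ss tt|a b]; first by rewrite !linear0.
  by rewrite !linearD /= ss tt.
apply/lfunP => m; rewrite crossed_ker_tens // !zero_lfunE.
have := crossed_ker_homA b DK; rewrite H0 memv0 => /eqP ->.
by rewrite zero_lfunE.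
Qed.

End Crossed.

(** The map [G] is a bijection from the point derivations: conversely, D (1 (x) b) lies in End_A(M)
    = k, and its scalar is a derivation in b. *)
Lemma dim_crossed_ker (M : rmod A) : \1%VF != 0 :> 'End(M) ->
  homA M M = <[\1%VF]>%VS -> \dim (crossed_ker M M) = \dim (derivations eps).
Proof.
move=> M0 H1.
pose G (d : 'Hom(B, k^o)) : 'Hom(T, 'End(M)) :=
  linfun (fun x => linfun (fun m : M => ract m (contract d x))).
have GE d x m : G d x m = ract m (contract d x).
  apply: (linfun2E (h := fun x (m : M) => ract m (contract d x))) => ? c u v.
    exact: ract_linl.
  by rewrite linearP ract_linr.
have GL : linear G.
  move=> c d d'; apply/lfunP => x; apply/lfunP => m.
  rewrite !(add_lfunE, scale_lfunE) !GE -ractZr -ractDr; congr (ract m _).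
  move: x; apply: tens_ind => [|s t ss tt|a b]; first by rewrite !linear0 addr0.
    by rewrite !linearD /= ss tt ?scalerDr addrACA.
  by rewrite !contractE add_lfunE scale_lfunE scalerDl scalerA.
have [m0 m0N] := lfunPn M0; rewrite id_lfunE zero_lfunE in m0N.
rewrite -(@dim_limg_inj _ _ _ (linfun G)) => [|d _]; last first.
  rewrite linfunE // => Gd; apply/lfunP => b; apply/eqP.
  have := GE d (tens 1 b) m0; rewrite Gd !zero_lfunE contractE ractZr ract1.
  by move/esym/eqP; rewrite scaler_eq0 (negPf m0N) orbF.
congr (\dim _); apply/vspaceP => D.
apply/idP/memv_imgP => [DK|[d /derivationsP dD ->]].
  have [|d dE] := @scalar_family _ _ _ (D \o tens_inr)%VF M0.
    by move=> b; rewrite comp_lfunE -H1 crossed_ker_homA.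
  exists d.
    apply/derivationsP => x y; apply/eqP; rewrite -subr_eq0.
    have /crossed_kerP[Dc _] := DK.
    have dEm b : D (tens_inr b) m0 = d b *: m0.
      by rewrite -comp_lfunE dE scale_lfunE id_lfunE.
    have pE (m : M) b : ract m (pi (tens_inr b)) = (eps b : k) *: m.
      by rewrite tens_inrE contractE ractZr ract1.
    have := Dc (tens_inr x) (tens_inr y) m0; rewrite -tens_inrM !dEm /=.
    rewrite /pullback_act !pE [D (tens_inr y) _]linearZ /= dEm !scalerA.
    rewrite -scalerDl => /eqP; rewrite -subr_eq0 -scalerBl scaler_eq0.
    by rewrite (negPf m0N) orbF [_ * d x]mulrC.
  rewrite linfunE //; apply/lfunP; apply: tens_ind => [|s t ss tt|a b].
  - by rewrite !linear0.
  - by rewrite !linearD /= ss tt.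
  apply/lfunP => m; rewrite crossed_ker_tens // GE contractE ractZr.
  by rewrite -comp_lfunE dE scale_lfunE id_lfunE.
rewrite linfunE //; apply/crossed_kerP; split=> [x y m|a].
  by rewrite !GE contract_derivation // ractDr !ractM.
apply/lfunP => m; rewrite GE tens_inlE contractE (derivation1 eps1 dD).
by rewrite scale0r ractr0 zero_lfunE.
Qed.

End Tensor.

(** * Modules on which the algebra acts through the augmentation *)

Section OneDimensional.
Variables (k : fieldType) (B : falgType k) (eps : 'Hom(B, k^o)).
Hypotheses (eps1 : eps 1 = 1).
Variable M : rmod B.
Hypothesis M_eps : forall (m : M) b, ract m b = (eps b : k) *: m.

Lemma homA_scalar_action (N : rmod B) :
  (forall (n : N) b, ract n b = (eps b : k) *: n) -> homA M N = fullv.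
Proof.
move=> N_eps; apply/vspaceP => f; rewrite memvf; apply/homAP => m b.
by rewrite M_eps N_eps linearZ.
Qed.

(** All linear endomorphisms are A-linear here, so in [dim_ext1E] the Hom terms cancel and Ext^1 has
    the dimension of Z^1. Since End_k(M) = k, a crossed homomorphism is a point derivation times the
    identity. *)
Lemma dim_ext1_one_dim : \1%VF != 0 :> 'End(M) ->
  homA M M = <[\1%VF]>%VS -> dim_ext1 M M = \dim (derivations eps).
Proof.
move=> M0 H1; have Hf := homA_scalar_action M_eps.
have := dim_ext1E M M; rewrite Hf => /addIn ->.
pose G (d : 'Hom(B, k^o)) : 'Hom(B, 'End(M)) :=
  linfun (fun b => (d b : k) *: \1%VF).
have GE d b : G d b = (d b : k) *: \1%VF.
  by rewrite linfunE // => c u v; rewrite linearP scalerDl scalerA.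
have GL : linear G.
  move=> c d d'; apply/lfunP => x.
  rewrite !(add_lfunE, scale_lfunE) !GE scalerA -scalerDl.
  by rewrite add_lfunE scale_lfunE.
have [m0 m0N] := lfunPn M0; rewrite id_lfunE zero_lfunE in m0N.
rewrite -(@dim_limg_inj _ _ _ (linfun G)) => [|d _]; last first.
  rewrite linfunE // => Gd; apply/lfunP => b; apply/eqP.
  have /eqP := GE d b; rewrite Gd !zero_lfunE eq_sym scaler_eq0.
  by rewrite (negPf M0) orbF.
congr (\dim _); apply/vspaceP => D.
apply/idP/memv_imgP => [/crossedP DK|[d /derivationsP dD ->]].
  have [|d dE] := @scalar_family _ _ _ D M0.
    by move=> b; rewrite -H1 Hf memvf.
  exists d; last by rewrite linfunE //; apply/lfunP => b; rewrite GE dE.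
  apply/derivationsP => x y; apply/eqP; rewrite -subr_eq0.
  have := DK x y m0; rewrite !M_eps !dE !scale_lfunE !id_lfunE.
  rewrite !scalerA -scalerDl => /eqP; rewrite -subr_eq0 -scalerBl scaler_eq0.
  by rewrite (negPf m0N) orbF [_ * d x]mulrC [_ * eps x]mulrC.
apply/crossedP => x y m.
rewrite linfunE // !GE !M_eps !scale_lfunE !id_lfunE dD.
by rewrite !scalerA -scalerDl [_ * d x]mulrC [_ * eps x]mulrC.
Qed.

End OneDimensional.

(** * Frobenius-Perron dimension *)

Section Submodule.
Variables (k : fieldType) (A : falgType k) (M : rmod A) (U : {vspace M}).
Hypothesis UA : forall u a, u \in U -> ract u a \in U.

Definition submod_act (u : subvs_of U) (a : A) : subvs_of U :=
  vsproj U (ract (vsval u) a).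

Lemma submod_actE u a : vsval (submod_act u a) = ract (vsval u) a.
Proof. by apply/vsprojK/UA/subvsP. Qed.

Fact submod_act_linl a : linear (submod_act^~ a).
Proof.
move=> c u v; apply: subvs_inj.
have vP x y : vsval (c *: x + y) = c *: vsval x + vsval y by apply: linearP.
by rewrite submod_actE [RHS]vP !submod_actE vP ract_linl.
Qed.

Fact submod_act_linr u : linear (submod_act u).
Proof.
move=> c a b; apply: subvs_inj.
have vP x y : vsval (c *: x + y) = c *: vsval x + vsval y by apply: linearP.
by rewrite submod_actE [RHS]vP !submod_actE ract_linr.
Qed.

Fact submod_act1 u : submod_act u 1 = u.
Proof. by apply: subvs_inj; rewrite submod_actE ract1. Qed.

Fact submod_actM u a b : submod_act u (a * b) = submod_act (submod_act u a) b.
Proof. by apply: subvs_inj; rewrite !submod_actE ractM. Qed.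

Definition submod : rmod A :=
  RMod submod_act_linl submod_act_linr submod_act1 submod_actM.

End Submodule.

(** * Existence of a brick *)

Section BrickExistence.
Variables (k : fieldType) (A : falgType k).

Fact regular_linl (b : A) : linear (fun a : A => a * b).
Proof. by move=> c x y; rewrite mulrDl scalerAl. Qed.

Fact regular_linr (a : A) : linear (fun b : A => a * b).
Proof. by move=> c x y; rewrite mulrDr scalerAr. Qed.

Definition regular : rmod A :=
  RMod regular_linl regular_linr (@mulr1 A) (@mulrA A).

Lemma homA_inv (M N : rmod A) (f : 'Hom(M, N)) :
  f \in homA M N -> lker f == 0%VS -> limg f = fullv -> (f^-1)%VF \in homA N M.
Proof.
move=> /homAP fA kf fS; apply/homAP => n a.
have fK m : f ((f^-1)%VF m) = m by rewrite limg_lfunVK ?fS ?memvf.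
by move/lker0P: kf; apply; rewrite fA !fK.
Qed.

(** A nonzero module of least dimension is a brick: the kernel of a nonzero endomorphism is a proper
    submodule, hence zero. *)
Lemma exists_brick : exists M : rmod A, brick M.
Proof.
pose P n := `[< exists2 M : rmod A, \dim {: M} = n & (0 < n)%N >].
have exP : exists n, P n.
  exists (\dim {: A}); apply/asboolP; exists regular => //.
  exact: adim_gt0.
case: (ex_minnP exP) => n /asboolP[M Mn n0] nmin; exists M; split.
  by rewrite lfun1_eq0 Mn -lt0n.
move=> f fA f0.
have kfA u a : u \in lker f -> ract u a \in lker f.
  by rewrite ![_ \in lker f]memv_ker (homAP _ fA) => /eqP ->; rewrite ract0.
have dimk : \dim {: submod kfA} = \dim (lker f) by rewrite dimvf.
have kf : lker f == 0%VS.
  rewrite -dimv_eq0 -leqn0 leqNgt; apply: contra f0 => k0.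
  have : (n <= \dim (lker f))%N.
    by apply: nmin; apply/asboolP; exists (submod kfA).
  rewrite -Mn => le_dim.
  have /eqP kfull : lker f == fullv by rewrite eqEdim subvf.
  by apply/eqP/lfunP => m; apply/eqP; rewrite zero_lfunE -memv_ker kfull memvf.
exists (f^-1)%VF; split; last exact: lker0_compfV.
  by apply: homA_inv => //; apply: lker0_limgf.
exact: lker0_compVf.
Qed.

End BrickExistence.

Lemma semibrick1 (k : fieldType) (A : falgType k) (M : rmod A) :
  brick M -> semibrick (fun _ : 'I_1 => M).
Proof. by move=> bM; split=> // i j; rewrite !ord1. Qed.

Section FPdimSup.
Variables (R : realType) (k : fieldType) (A : falgType k).

Lemma FPdim_ge n (S : 'I_n -> rmod A) : semibrick S ->
  ((spectral_radius R (ext_quiver S))%:E <= FPdim R A)%E.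
Proof. by move=> bS; apply: ereal_sup_ubound; exists n, S. Qed.

Lemma FPdim_le x : (forall n (S : 'I_n -> rmod A), semibrick S ->
    ((spectral_radius R (ext_quiver S))%:E <= x)%E) -> (FPdim R A <= x)%E.
Proof. by move=> Sx; apply/ereal_supP => _ [n [S [bS ->]]]; apply: Sx. Qed.

Lemma FPdim_ge0 : (0 <= FPdim R A)%E.
Proof.
have [M bM] := exists_brick A; apply: le_trans (FPdim_ge (semibrick1 bM)).
by rewrite lee_fin spectral_radius_ge0.
Qed.

End FPdimSup.

(** * Comparison of semibricks and the final computation *)

Section Main.
Variables (R : realType) (k : closedFieldType) (A B : falgType k).
Variable eps : 'Hom(B, k^o).
Hypotheses (eps1 : eps 1 = 1) (epsM : forall x y, eps (x * y) = eps x * eps y).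
Hypothesis eps_nil : exists n, (lker eps ^+ n = 0)%VS.
Local Notation d := (\dim (derivations eps)).
Local Notation infl := (inflation eps1 epsM).

Lemma FPdim_augmented : FPdim R B = (d%:R)%:E.
Proof.
have brickE (M : rmod B) :
    brick M -> forall (m : M) b, ract m b = (eps b : k) *: m.
  move=> bM m b.
  have M0 : forall (m : M) b, eps b = 0 -> ract m (\1%VF b) = 0.
    apply: (brick_augmentation_ideal eps1 epsM eps_nil) bM
      => [x y|P P0 PD Pc x].
      by rewrite !id_lfunE.
    (* With the identity of B as j, the central element 1 alone gives the span hypothesis. *)
    rewrite -[x]mul1r -[x in _ * x]id_lfunE; apply: Pc => b'.
    by rewrite mul1r mulr1.
  rewrite -{1}[b](subrK (eps b)%:A) ractDr ractZr ract1.
  by rewrite -[b - _]id_lfunE M0 ?eps_ker // add0r.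
have ext_d (M : rmod B) : brick M -> dim_ext1 M M = d.
  move=> bM; apply: dim_ext1_one_dim (brick_homA bM); last by case: bM.
  exact: brickE.
apply/eqP; rewrite eq_le; apply/andP; split.
  apply: FPdim_le => -[|[|n]] S [bS hS].
  - by rewrite spectral_radius0 lee_fin ler0n.
  - by rewrite spectral_radius1 mxE ext_d.
  (* Two distinct members are impossible: Hom between them consists of all linear maps, which is
     nonzero. *)
  have [|_] := hS ord0 (lift ord0 ord0); first by [].
  rewrite (homA_scalar_action (brickE _ (bS _)) (brickE _ (bS _))) => /eqP.
  have dimS i : \dim {: S i} != 0%N by case: (bS i) => S0 _; rewrite -lfun1_eq0.
  by rewrite -dimv_eq0 dimvf muln_eq0 -!dimvf (negPf (dimS _)) (negPf (dimS _)).
have [M bM] := exists_brick B; apply: le_trans (FPdim_ge R (semibrick1 bM)).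
by rewrite spectral_radius1 mxE ext_d.
Qed.

Lemma brick_inflation (M : rmod A) : brick (infl M) <-> brick M.
Proof. by rewrite /brick homA_inflation. Qed.

Lemma semibrick_inflation n (S : 'I_n -> rmod A) :
  semibrick (fun i => infl (S i)) <-> semibrick S.
Proof.
split=> -[bS hS]; split=> [i|i j ij]; try exact/brick_inflation.
- have := hS i j ij; rewrite /isomorphic !homA_inflation; exact.
- rewrite /isomorphic !homA_inflation; exact: hS.
Qed.

(** Off the diagonal Hom_A vanishes, and with it the correction term; on the diagonal Hom_A is k by
    Schur's lemma, leaving d. *)
Lemma ext_quiver_inflation n (S : 'I_n -> rmod A) : semibrick S ->
  ext_quiver (fun i => infl (S i)) =
    \matrix_(i, j) (ext_quiver S i j + (i == j) * d)%N.
Proof.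
case=> bS hS; apply/matrixP => i j; rewrite !mxE dim_ext1_inflation.
congr (_ + _)%N.
have [<-|ij] := eqVneq i j.
  by rewrite mul1n dim_crossed_ker //; [case: (bS i) | apply: brick_homA].
by rewrite crossed_ker0 ?dimv0 //; case: (hS i j ij).
Qed.

Lemma semibrick_tensor n (S : 'I_n -> rmod (A \tensor B)) : semibrick S ->
  exists S0, S = (fun i => infl (S0 i)).
Proof.
case=> bS _.
exists (fun i => pullback (@tens_inl1 _ A B) (@tens_inlM _ A B) (S i)).
apply: funext => i; rewrite inflation_restriction //.
apply: (brick_augmentation_ideal eps1 epsM eps_nil) (bS i).
  exact: tens_inrM.
exact: tens_span.
Qed.

Lemma FPdim_tensor : FPdim R (A \tensor B) = (FPdim R A + d%:R%:E)%E.
Proof.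
have rhoE n (S : 'I_n.+1 -> rmod A) : semibrick S ->
    spectral_radius R (ext_quiver (fun i => infl (S i))) =
    spectral_radius R (ext_quiver S) + d%:R.
  by move=> bS; rewrite ext_quiver_inflation // spectral_radius_add_scalar.
have d0 : (0 <= (d%:R : R)%:E)%E by rewrite lee_fin ler0n.
have ge_rho n (S : 'I_n.+1 -> rmod A) : semibrick S ->
    ((spectral_radius R (ext_quiver S))%:E + d%:R%:E
       <= FPdim R (A \tensor B))%E.
  move=> bS; rewrite -EFinD -rhoE //; apply: FPdim_ge.
  exact/semibrick_inflation.
apply/eqP; rewrite eq_le; apply/andP; split.
  apply: FPdim_le => -[|n] S bS.
    by rewrite spectral_radius0 adde_ge0 // FPdim_ge0.
  have [S0 SE] := semibrick_tensor bS; rewrite SE in bS *.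
  move/semibrick_inflation in bS.
  by rewrite rhoE // EFinD leeD2r // FPdim_ge.
rewrite -leeBrDr //; apply: FPdim_le => -[|n] S bS;
  rewrite leeBrDr //; last exact: ge_rho.
(* The shift by d fails for the empty semibrick of A, so a single brick, whose radius is at least 0,
   is used in its place. *)
rewrite spectral_radius0; have [M bM] := exists_brick A.
apply: le_trans (ge_rho _ _ (semibrick1 bM)).
by rewrite leeD2r // lee_fin spectral_radius_ge0.
Qed.

End Main.

Theorem theorem2 (R : realType) (k : closedFieldType) (A B : falgType k)
    (localB : local_algebra B) :
  FPdim R (A \tensor B) = (FPdim R A + FPdim R B)%E.
Proof.
have [eps [eps1 epsM eps_nil]] := local_augmentation localB.
rewrite (FPdim_tensor R A eps1 epsM eps_nil).
by rewrite (FPdim_augmented R eps1 epsM eps_nil).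
Qed.
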